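(* Let $K$ be a field of prime characteristic $p$ and let $(A,A_1)$ be a Frobenius pair (over $K$) satisfying the derivation hypothesis, such that $\operatorname{gr} A$ and $\operatorname{gr} A_1$ are unique factorisation domains. Let $I$ be a reflexive two-sided ideal of $A$. Then $I\cap A_1$ is a reflexive two-sided ideal of $A_1$, and $I$ is controlled by $A_1$: \[ I=(I\cap A_1)\cdot A .\]
   Context: Filtered rings. A filtered ring $R$ has a filtration by additive subgroups $F_nR$ ($n\in\mathbb{Z}$) with $R=\bigcup_n F_nR$, $1\in F_0R$, $F_nR\subseteq F_{n+1}R$, $F_nR\,F_mR\subseteq F_{n+m}R$; filtrations are always separated: $\bigcap_n F_nR=0$. The degree of $x\neq 0$ is the unique $n$ with $x\in F_nR\setminus F_{n-1}R$. $\operatorname{gr}R=\bigoplus_n F_nR/F_{n-1}R$ is the associated graded ring, and $\operatorname{gr}x=x+F_{n-1}R$ is the principal symbol of $x$ of degree $n$. ''Complete'' means complete for the topology defined by the filtration. Frobenius pairs. Let $A$ be a complete filtered $K$-algebra and $A_1$ a subalgebra with the subspace filtration $F_nA_1=F_nA\cap A_1$. $(A,A_1)$ is a Frobenius pair if: (i) $A_1$ is closed in $A$; (ii) $B:=\operatorname{gr}A$ is a commutative noetherian domain; (iii) the image $B_1$ of $\operatorname{gr}A_1$ in $B$ satisfies $B^{[p]}\subseteq B_1$, where $B^{[p]}=\{b^p:b\in B\}$; (iv) there are a positive integer $t$ and homogeneous $y_1,\dots,y_t\in B$ with $B=\bigoplus_{\alpha\in\{0,\dots,p-1\}^t}B_1\mathbf{y}^\alpha$,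 where $\mathbf{y}^\alpha=y_1^{\alpha_1}\cdots y_t^{\alpha_t}$. Derivation hypothesis. If $a\in A$ and $n\ge 0$ satisfy $[a,F_kA]\subseteq F_{k-n}A$ for all $k\in\mathbb{Z}$, then $\{a,-\}_n:B\to B$ is the graded derivation given by $b+F_{k-1}A\mapsto [a,b]+F_{k-n-1}A$ for $b\in F_kA$. A source of derivations for $(A,A_1)$ is $\mathbf{a}=\{a_0,a_1,a_2,\dots\}\subseteq A$ (an indexed family), together with natural numbers $\theta(a_r),\theta_1(a_r)$, such that for all $r\geq 0$ and $k\in\mathbb{Z}$: $[a_r,F_kA]\subseteq F_{k-\theta(a_r)}A$, $[a_r,F_kA_1]\subseteq F_{k-\theta_1(a_r)}A$, and $\theta_1(a_r)-\theta(a_r)\to\infty$ as $r\to\infty$. $\mathcal{S}(A,A_1)$ is the set of all sources of derivations. For a graded ideal $I'$ of $B$, a homogeneous $Y\in B$ lies in the $\mathbf{a}$-closure of $I'$ if $\{a_r,Y\}_{\theta(a_r)}\in I'$ for all $r\gg 0$. Let $\mathcal{D}=\operatorname{Der}_{B_1}(B)$ be the set of $B_1$-linear derivations of $B$. $(A,A_1)$ satisfies the derivation hypothesis if for all homogeneous $X,Y\in B$: whenever $Y$ lies in the $\mathbf{a}$-closure of $XB$ for all $\mathbf{a}\in\mathcal{S}(A,A_1)$, then $\mathcal{D}(Y)\subseteq XB$. Reflexive ideals. A right $A$-module $M$ is reflexive if the canonical map from $M$ to its double dual $M^{**}$ (with respect to $\operatorname{Hom}(-,A)$) is an isomorphism,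 and similarly for left modules; a two-sided ideal is reflexive if it is reflexive both as a right and as a left module. *)

(* Defs.v *)
From HB Require Import structures.
From mathcomp Require Import all_boot all_order all_algebra.
From mathcomp Require Import finmap all_classical.
From mathcomp Require Import ring.

Set Implicit Arguments.
Unset Strict Implicit.
Unset Printing Implicit Defensive.

Import Order.TTheory GRing.Theory Num.Theory.

Local Open Scope classical_set_scope.
Local Open Scope ring_scope.

Record filtration (R : nzRingType) := Filtration {
  fil :> int -> set R;
  fil0 : forall n, fil n 0;
  filB : forall n x y, fil n x -> fil n y -> fil n (x - y);
  fil1 : fil 0 1;
  fil_incr : forall n, fil n `<=` fil (n + 1);
  filM : forall n m x y, fil n x -> fil m y -> fil (n + m) (x * y);
  fil_exhaustive : \bigcup_n fil n = setT;
  fil_separated : \bigcap_n fil n = [set 0] }.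

(* The filtration topology: the sets x + F_n form a base of neighbourhoods
   of x, so Cauchy sequences suffice to express completeness. *)
Definition fil_open (R : nzRingType) (F : filtration R) (U : set R) : Prop :=
  forall x, U x -> exists n : int, forall y, F n (y - x) -> U y.

Definition fil_closed (R : nzRingType) (F : filtration R) (C : set R) : Prop :=
  fil_open F (~` C).

Definition fil_cauchy (R : nzRingType) (F : filtration R) (u : nat -> R) :=
  forall n : int, exists N : nat, forall i j : nat,
    (N <= i)%N -> (N <= j)%N -> F n (u i - u j).

Definition fil_cvg (R : nzRingType) (F : filtration R) (u : nat -> R) (l : R) :=
  forall n : int, exists N : nat, forall i : nat, (N <= i)%N -> F n (u i - l).

Definition fil_complete (R : nzRingType) (F : filtration R) : Prop :=
  forall u : nat -> R, fil_cauchy F u -> exists l, fil_cvg F u l.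

Section FiltrationTheory.
Variables (R : nzRingType) (F : filtration R).

Lemma filN n x : F n x -> F n (- x).
Proof. by move=> Fx; rewrite -sub0r; apply: filB => //; exact: fil0. Qed.

Lemma filD n x y : F n x -> F n y -> F n (x + y).
Proof. by move=> Fx Fy; rewrite -[y]opprK; apply: filB => //; exact: filN. Qed.

Lemma fil_sum n (I : Type) (r : seq I) (P : pred I) (f : I -> R) :
  (forall i, P i -> F n (f i)) -> F n (\sum_(i <- r | P i) f i).
Proof. by move=> Ff; elim/big_ind: _ => //; [exact: fil0|exact: filD]. Qed.

Lemma fil_addn n x (k : nat) : F n x -> F (n + k%:Z) x.
Proof.
move=> Fx; elim: k => [|k IHk]; first by rewrite addr0.
by rewrite -addn1 PoszD addrA; exact: fil_incr.
Qed.

Lemma fil_le n m x : (n <= m)%R -> F n x -> F m x.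
Proof.
rewrite -subr_ge0 => /gez0_abs nm /(fil_addn `|m - n|%N).
by rewrite nm subrKC.
Qed.

Lemma fil_m1_one : ~ F (- 1) 1.
Proof.
move=> F1; have Fk (k : nat) : F (- k%:Z) 1.
  elim: k => [|k IHk]; first by rewrite oppr0; exact: fil1.
  by rewrite -addn1 PoszD opprD -[X in F _ X]mulr1; exact: filM.
have : (\bigcap_n fil F n) 1.
  by move=> n _; apply: (fil_le _ (Fk (absz n))); rewrite abszE lerNl -normrN ler_norm.
by rewrite fil_separated => /= /eqP; rewrite oner_eq0.
Qed.

End FiltrationTheory.

(* [rees F] is the direct sum of the F_n, realised as finitely supported
   families; its product is the convolution product. *)
Section Rees.
Variables (R : nzRingType) (F : filtration R).

Definition rees_pred : {pred int -> R} :=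
  [pred f | `[< finite_set [set n | f n != 0] /\ forall n, F n (f n) >]].

Lemma rees_zmod_closed : zmod_closed rees_pred.
Proof.
split=> [|f g].
  apply/asboolP; split=> [|n]; last exact: fil0.
  by rewrite (_ : mkset _ = set0) // -subset0 => n /=; rewrite eqxx.
move=> /asboolP[ff Ff] /asboolP[fg Fg]; apply/asboolP; split=> [|n]; last first.
  exact: filB.
apply: (sub_finite_set (B := [set n | f n != 0] `|` [set n | g n != 0])).
  move=> n /=; rewrite -[(f - g) n]/(f n - g n) => fgn.
  have [f0|] := eqVneq (f n) 0; last by left.
  by right; apply: contraNneq fgn => g0; rewrite f0 g0 subr0.
by rewrite finite_setU.
Qed.

HB.instance Definition _ :=
  GRing.isZmodClosed.Build (int -> R) rees_pred rees_zmod_closed.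

Record rees := Rees { rees_val : int -> R; rees_valP : rees_val \in rees_pred }.

HB.instance Definition _ := [isSub for rees_val].
HB.instance Definition _ := [Choice of rees by <:].
HB.instance Definition _ := [SubChoice_isSubZmodule of rees by <:].

Lemma rees_fil (f : rees) n : F n (val f n).
Proof. by have /asboolP[] := rees_valP f. Qed.

Lemma rees_fin (f : rees) : finite_set [set n | val f n != 0].
Proof. by have /asboolP[] := rees_valP f. Qed.

Definition rees_supp (f : rees) : {fset int} := fset_set [set n | val f n != 0].

Lemma rees_suppP (f : rees) n : n \notin rees_supp f -> val f n = 0.
Proof.
rewrite in_fset_set; last exact: rees_fin.
by move=> /negP nf; apply/eqP; apply/negP => f0; apply: nf; rewrite inE /=; apply/negP.
Qed.

Definition conv (f g : int -> R) (n : int) : R :=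
  \sum_(i \in [set: int]) f i * g (n - i).

Lemma convE (A : {fset int}) (f g : int -> R) n :
  (forall i, i \notin A -> f i = 0) ->
  conv f g n = \sum_(i <- A) f i * g (n - i).
Proof. by move=> fA; apply: fsbigTE => i /fA ->; rewrite mul0r. Qed.

Lemma conv_rees (f g : rees) : conv (val f) (val g) \in rees_pred.
Proof.
apply/asboolP; split=> [|n]; last first.
  rewrite (convE _ _ (@rees_suppP f)); apply: fil_sum => i _.
  by rewrite -[n in F n](subrKC i); apply: filM; exact: rees_fil.
apply: (sub_finite_set (B := [set u.1 + u.2 | u in
    [set n | val f n != 0] `*` [set n | val g n != 0]])).
  move=> n /= /(@fsbigN1 R 0 +%R int int setT
    (fun n i => val f i * val g (n - i)) n)[i _ /= fgi].
  exists (i, n - i) => /=; last by rewrite subrKC.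
  by split; apply: contraNneq fgi => ->; rewrite ?mul0r ?mulr0.
by apply: finite_image; apply: finite_setX; exact: rees_fin.
Qed.

Definition rees_mul (f g : rees) : rees := Rees (conv_rees f g).

Definition delta (n : int) (x : R) : int -> R := fun m => if m == n then x else 0.

Lemma delta_rees n x : F n x -> delta n x \in rees_pred.
Proof.
move=> Fx; apply/asboolP; split=> [|m]; last first.
  by rewrite /delta; case: eqP => [->//|_]; exact: fil0.
apply: (sub_finite_set (B := [set n])); last exact: finite_set1.
by move=> m /=; rewrite /delta; case: (eqVneq m n) => // _; rewrite eqxx.
Qed.

Definition rees_one : rees := Rees (delta_rees (fil1 F)).

Lemma rees_mulA : associative rees_mul.
Proof.
move=> f g h; apply: val_inj; apply/funext => n.
pose A := [fset (i + j)%R | i in rees_supp f, j in rees_supp g]%fset.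
have fgA k : k \notin A -> val (rees_mul f g) k = 0.
  move=> kA /=; rewrite (convE _ _ (@rees_suppP f)); apply: big1_seq => i /= fi.
  rewrite [val g _]rees_suppP ?mulr0 //; apply: contra kA => gki.
  by apply/imfset2P; exists i => //; exists (k - i) => //; rewrite subrKC.
rewrite [LHS](convE _ _ (@rees_suppP f)) [RHS](convE _ _ fgA).
under [RHS]eq_bigr => k _ do
  rewrite /= (convE _ _ (@rees_suppP f)) mulr_suml.
rewrite exchange_big /= big_seq [RHS]big_seq; apply: eq_bigr => i fi.
under [RHS]eq_bigr => k _ do rewrite -mulrA.
rewrite -mulr_sumr; congr (_ * _).
rewrite /conv (reindex_fsbigT (fun k : int => k - i)); last first.
  by exists (fun k => k + i) => k; rewrite ?subrK ?addrK.
rewrite (fsbigTE A); last first.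
  move=> k kA; rewrite [val g _]rees_suppP ?mul0r //; apply: contra kA => gki.
  by apply/imfset2P; exists i => //; exists (k - i) => //; rewrite subrKC.
by apply: eq_bigr => k _; congr (_ * val h _); ring.
Qed.

Lemma rees_mul1 : left_id rees_one rees_mul.
Proof.
move=> f; apply: val_inj; apply/funext => n.
rewrite /= (convE (A := [fset 0%R]%fset)); last first.
  by move=> i; rewrite inE /delta => /negPf ->.
by rewrite big_seq_fset1 /delta eqxx mul1r subr0.
Qed.

Lemma rees_mulr1 : right_id rees_one rees_mul.
Proof.
move=> f; apply: val_inj; apply/funext => n.
rewrite /= /conv (fsbigTE [fset n]%fset); last first.
  by move=> i; rewrite inE /delta subr_eq0 eq_sym => /negPf ->; rewrite mulr0.
by rewrite big_seq_fset1 /delta subrr eqxx mulr1.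
Qed.

Lemma rees_mulDl : left_distributive rees_mul +%R.
Proof.
move=> f g h; apply: val_inj; apply/funext => n.
pose A := (rees_supp f `|` rees_supp g)%fset.
have fA i : i \notin A -> val f i = 0.
  by rewrite inE negb_or => /andP[/rees_suppP-> _].
have gA i : i \notin A -> val g i = 0.
  by rewrite inE negb_or => /andP[_ /rees_suppP->].
have fgA i : i \notin A -> val (f + g) i = 0.
  by move=> iA; rewrite /= [LHS](_ : _ = val f i + val g i) // fA // gA // addr0.
rewrite [LHS](convE _ _ fgA).
rewrite [RHS](_ : _ = conv (val f) (val h) n + conv (val g) (val h) n) //.
rewrite (convE _ _ fA) (convE _ _ gA) -big_split; apply: eq_bigr => i _.
by rewrite /= -mulrDl.
Qed.

Lemma rees_mulDr : right_distributive rees_mul +%R.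
Proof.
move=> f g h; apply: val_inj; apply/funext => n.
rewrite [RHS](_ : _ = conv (val f) (val g) n + conv (val f) (val h) n) //.
rewrite [LHS](convE _ _ (@rees_suppP f)) !(convE _ _ (@rees_suppP f)).
by rewrite -big_split; apply: eq_bigr => i _; rewrite /= -mulrDr.
Qed.

Lemma rees_one_neq0 : rees_one != 0.
Proof.
apply/eqP => /(congr1 (fun f => val f 0)).
by rewrite /= /delta eqxx => /eqP; rewrite oner_eq0.
Qed.

HB.instance Definition _ := GRing.Zmodule_isNzRing.Build rees
  rees_mulA rees_mul1 rees_mulr1 rees_mulDl rees_mulDr rees_one_neq0.

End Rees.

Section Gr.
Variables (R : nzRingType) (F : filtration R).

Definition gr_rel : {pred rees F} :=
  [pred f | `[< forall n, F (n - 1) (val f n) >]].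

Lemma gr_rel_zmod_closed : zmod_closed gr_rel.
Proof.
split=> [|f g /asboolP Ff /asboolP Fg]; apply/asboolP => n; first exact: fil0.
exact: filB.
Qed.

HB.instance Definition _ :=
  GRing.isZmodClosed.Build (rees F) gr_rel gr_rel_zmod_closed.

Lemma gr_relMl f g : f \in gr_rel -> f * g \in gr_rel.
Proof.
move=> /asboolP Ff; apply/asboolP => n.
rewrite /= (convE _ _ (@rees_suppP _ _ f)); apply: fil_sum => i _.
by rewrite (_ : n - 1 = i - 1 + (n - i)); [apply: filM => //; exact: rees_fil|ring].
Qed.

Lemma gr_relMr f g : g \in gr_rel -> f * g \in gr_rel.
Proof.
move=> /asboolP Fg; apply/asboolP => n.
rewrite /= (convE _ _ (@rees_suppP _ _ f)); apply: fil_sum => i _.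
by rewrite (_ : n - 1 = i + (n - i - 1)); [apply: filM => //; exact: rees_fil|ring].
Qed.

(* The direct sum of the F_n modulo the direct sum of the F_(n-1). *)
Definition gr := {ideal_quot (gr_rel : zmodClosed (rees F))}.

HB.instance Definition _ := GRing.Zmodule.on gr.
HB.instance Definition _ := EqQuotient.on gr.

Definition gr_pi (f : rees F) : gr := (\pi_gr f)%qT.
Definition gr_lift (u : gr) : rees F := repr u.

Lemma gr_liftK : cancel gr_lift gr_pi.
Proof. exact: reprK. Qed.

Lemma gr_piP f g : reflect (gr_pi f = gr_pi g) (f - g \in gr_rel).
Proof. by rewrite Quotient.idealrBE; exact: eqP. Qed.

Lemma gr_pi_zmod_morphism : zmod_morphism gr_pi.
Proof. by move=> f g; rewrite /gr_pi [LHS]raddfB. Qed.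

HB.instance Definition _ :=
  GRing.isZmodMorphism.Build (rees F) gr gr_pi gr_pi_zmod_morphism.

Definition gr_mul (u v : gr) : gr := gr_pi (gr_lift u * gr_lift v).

Lemma gr_piM f g : gr_pi (f * g) = gr_mul (gr_pi f) (gr_pi g).
Proof.
apply/gr_piP; set f' := gr_lift _; set g' := gr_lift _.
have -> : f * g - f' * g' = (f - f') * g + f' * (g - g').
  by rewrite mulrBl mulrBr addrA subrK.
by apply: rpredD; [apply: gr_relMl|apply: gr_relMr]; apply/gr_piP; rewrite gr_liftK.
Qed.

Lemma gr_mulA : associative gr_mul.
Proof.
move=> u v w; rewrite -(gr_liftK u) -(gr_liftK v) -(gr_liftK w).
by rewrite -!gr_piM mulrA.
Qed.

Lemma gr_mul1 : left_id (gr_pi 1) gr_mul.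
Proof. by move=> u; rewrite -(gr_liftK u) -gr_piM mul1r. Qed.

Lemma gr_mulr1 : right_id (gr_pi 1) gr_mul.
Proof. by move=> u; rewrite -(gr_liftK u) -gr_piM mulr1. Qed.

Lemma gr_mulDl : left_distributive gr_mul +%R.
Proof.
move=> u v w; rewrite -(gr_liftK u) -(gr_liftK v) -(gr_liftK w).
by rewrite -raddfD -!gr_piM -raddfD mulrDl.
Qed.

Lemma gr_mulDr : right_distributive gr_mul +%R.
Proof.
move=> u v w; rewrite -(gr_liftK u) -(gr_liftK v) -(gr_liftK w).
by rewrite -raddfD -!gr_piM -raddfD mulrDr.
Qed.

Lemma gr_one_neq0 : gr_pi 1 != 0.
Proof.
apply/eqP; rewrite -(raddf0 gr_pi) => /gr_piP; rewrite subr0 => /asboolP/(_ 0).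
by rewrite sub0r /= /delta eqxx => /fil_m1_one.
Qed.

HB.instance Definition _ := GRing.Zmodule_isNzRing.Build gr
  gr_mulA gr_mul1 gr_mulr1 gr_mulDl gr_mulDr gr_one_neq0.

(* [symb n x] is the class x + F_(n-1) in degree n; junk value 0 if x is not
   in F_n. *)
Definition symb (n : int) (x : R) : gr := gr_pi (insubd (0 : rees F) (delta n x)).

Definition homogeneous (Y : gr) : Prop := exists n x, F n x /\ Y = symb n x.

Lemma symbE n x : F n x -> val (insubd (0 : rees F) (delta n x)) = delta n x.
Proof. by move=> Fx; rewrite insubdK // delta_rees. Qed.

Lemma symbM n m x y : F n x -> F m y -> symb n x * symb m y = symb (n + m) (x * y).
Proof.
move=> Fx Fy; rewrite /symb -[LHS]gr_piM; congr gr_pi; apply: val_inj.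
rewrite (symbE (filM Fx Fy)) /= (symbE Fx) (symbE Fy).
apply/funext => k; rewrite (convE (A := [fset n]%fset)); last first.
  by move=> i; rewrite inE /delta => /negPf ->.
by rewrite big_seq_fset1 /delta eqxx subr_eq [m + n]addrC; case: eqP; rewrite ?mulr0.
Qed.

Lemma symb_eq n x y : F n x -> F n y -> symb n x = symb n y <-> F (n - 1) (x - y).
Proof.
move=> Fx Fy; set u := insubd (0 : rees F) (delta n x).
set v := insubd (0 : rees F) (delta n y).
have uvE m : val (u - v) m = delta n x m - delta n y m.
  by rewrite -(symbE Fx) -(symbE Fy).
split=> [/gr_piP/asboolP/(_ n)|Fxy]; first by rewrite uvE /delta eqxx.
apply/gr_piP/asboolP => m; rewrite uvE /delta.
by case: eqP => [->//|_]; rewrite subr0; exact: fil0.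
Qed.

End Gr.

(* The map gr R -> gr S of degree -d induced by an additive map sending F_k
   to G_(k-d), namely x + F_(k-1) |-> phi x + G_(k-d-1); see [gr_map_symb]. *)
Section GrMap.
Variables (R S : nzRingType) (F : filtration R) (G : filtration S).
Variables (phi : {additive R -> S}) (d : int).
Hypothesis phi_deg : forall k x, F k x -> G (k - d) (phi x).

Lemma rees_map_subproof (f : rees F) :
  (fun k => phi (val f (k + d))) \in rees_pred G.
Proof.
apply/asboolP; split=> [|k]; last first.
  by rewrite -[k in G k](addrK d); apply: phi_deg; exact: rees_fil.
apply: (sub_finite_set (B := [set n - d | n in [set n | val f n != 0]])).
  move=> k /= phik; exists (k + d); last by rewrite addrK.
  by apply: contraNneq phik => ->; rewrite raddf0.
by apply: finite_image; exact: rees_fin.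
Qed.

Definition rees_map (f : rees F) : rees G := Rees (rees_map_subproof f).

Definition gr_map (u : gr F) : gr G := gr_pi (rees_map (gr_lift u)).

Lemma gr_map_pi f : gr_map (gr_pi f) = gr_pi (rees_map f).
Proof.
apply/gr_piP/asboolP => k; set f' := gr_lift _.
have /asboolP ff' : f' - f \in @gr_rel R F by apply/gr_piP; rewrite gr_liftK.
rewrite [val _ k](_ : _ = phi (val (f' - f) (k + d))); last by rewrite [RHS]raddfB.
by rewrite (_ : k - 1 = k + d - 1 - d); [exact: phi_deg|ring].
Qed.

Lemma gr_map_symb k x : F k x -> gr_map (symb F k x) = symb G (k - d) (phi x).
Proof.
move=> Fx; rewrite /symb gr_map_pi; congr gr_pi; apply: val_inj.
rewrite (symbE (phi_deg Fx)) /= (symbE Fx); apply/funext => j.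
by rewrite /delta -subr_eq opprK; case: eqP => //; rewrite raddf0.
Qed.

End GrMap.

Section SubFiltration.
Variables (R : nzRingType) (F : filtration R) (S : subringClosed R).

Record subring := Subring { subring_val : R; subring_valP : subring_val \in S }.

HB.instance Definition _ := [isSub for subring_val].
HB.instance Definition _ := [Choice of subring by <:].
HB.instance Definition _ := [SubChoice_isSubNzRing of subring by <:].

Definition sub_fil (n : int) : set subring := [set x | F n (val x)].

Lemma sub_filB n x y : sub_fil n x -> sub_fil n y -> sub_fil n (x - y).
Proof. by move=> Fx Fy; rewrite /sub_fil /mkset raddfB; exact: filB. Qed.

Lemma sub_filM n m x y : sub_fil n x -> sub_fil m y -> sub_fil (n + m) (x * y).
Proof. by move=> Fx Fy; rewrite /sub_fil /mkset rmorphM; exact: filM. Qed.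

Lemma sub_fil_exhaustive : \bigcup_n sub_fil n = setT.
Proof.
apply/seteqP; split=> // x _.
have : (\bigcup_n fil F n) (val x) by rewrite fil_exhaustive.
by move=> [n _ Fx]; exists n.
Qed.

Lemma sub_fil_separated : \bigcap_n sub_fil n = [set 0].
Proof.
apply/seteqP; split=> [x Fx|x -> n _]; last first.
  by rewrite /sub_fil /mkset raddf0; exact: fil0.
apply: val_inj; rewrite raddf0.
have : (\bigcap_n fil F n) (val x) by move=> n; exact: Fx.
by rewrite fil_separated.
Qed.

Definition sub_filtration : filtration subring :=
  @Filtration subring sub_fil (fun n => fil0 F n) sub_filB (fil1 F)
    (fun n x => @fil_incr _ F n (val x)) sub_filM
    sub_fil_exhaustive sub_fil_separated.

Lemma val_deg0 k (x : subring) : sub_filtration k x -> F (k - 0) (val x).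
Proof. by rewrite subr0. Qed.

Definition gr_incl : gr sub_filtration -> gr F :=
  gr_map (phi := val : {additive subring -> R}) val_deg0.

End SubFiltration.

Definition two_sided_ideal (R : nzRingType) (I : set R) : Prop :=
  [/\ I 0, forall x y, I x -> I y -> I (x + y),
      forall a x, I x -> I (a * x) & forall a x, I x -> I (x * a)].

Definition mul_set (R : nzRingType) (S T : set R) : set R :=
  [set x | exists n (s t : 'I_n -> R),
     [/\ forall i, S (s i), forall i, T (t i) & x = \sum_i s i * t i]].

Definition principal (R : nzRingType) (x : R) : set R := range (fun z => x * z).

Section Commutative.
Variable R : nzRingType.

Definition is_comm_domain : Prop :=
  (forall x y : R, x * y = y * x) /\
  (forall x y : R, x * y = 0 -> x = 0 \/ y = 0).

(* Only meant for commutative R, where all ideals are two-sided. *)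
Definition is_noetherian : Prop :=
  forall I : set R, two_sided_ideal I ->
    exists n (s : 'I_n -> R), I = [set \sum_i c i * s i | c in [set: 'I_n -> R]].

Definition is_unit (u : R) : Prop := exists v, u * v = 1 /\ v * u = 1.

Definition is_irreducible (x : R) : Prop :=
  [/\ x <> 0, ~ is_unit x &
      forall a b, x = a * b -> is_unit a \/ is_unit b].

Definition is_ufd : Prop :=
  [/\ is_comm_domain,
      forall x : R, x <> 0 -> ~ is_unit x ->
        exists n (s : 'I_n -> R),
          (forall i, is_irreducible (s i)) /\ x = \prod_i s i &
      forall n m (s : 'I_n -> R) (t : 'I_m -> R),
        (forall i, is_irreducible (s i)) -> (forall j, is_irreducible (t j)) ->
        \prod_i s i = \prod_j t j ->
        exists2 f : 'I_n -> 'I_m, bijective f &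
          forall i, exists2 u, is_unit u & t (f i) = u * s i].

End Commutative.

(* Right R-modules are left modules over the converse ring R^c.  The dual of
   a left R-module M is the right R-module of R-linear maps M -> R, with
   (f a)(m) = f(m) a, which is the scaling of (R^c)^o. *)
Section Dual.
Variables (R : nzRingType) (M : lmodType R).

Definition dual_pred : {pred M -> (R^c)^o} :=
  [pred f | `[< linear (f : M -> R^o) >]].

Lemma dual_submod_closed : submod_closed dual_pred.
Proof.
split=> [|a f g /asboolP lf /asboolP lg]; apply/asboolP => b x y.
  by rewrite scaler0 addr0.
rewrite -[LHS]/((f (b *: x + y) : R) * a + g (b *: x + y)).
rewrite -[RHS]/(b * ((f x : R) * a + g x) + ((f y : R) * a + g y)).
rewrite [f _]lf [g _]lg -![_ *: _]/(_ * _).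
by rewrite mulrDl mulrDr mulrA addrACA.
Qed.

HB.instance Definition _ :=
  GRing.isSubmodClosed.Build (R^c) (M -> (R^c)^o) dual_pred dual_submod_closed.

Record dual := Dual { dual_val : M -> (R^c)^o; dual_valP : dual_val \in dual_pred }.

HB.instance Definition _ := [isSub for dual_val].
HB.instance Definition _ := [Choice of dual by <:].
HB.instance Definition _ := [SubChoice_isSubLmodule of dual by <:].

End Dual.

Section Reflexive.
Variables (R : nzRingType) (M : lmodType R).

Lemma bidual_subproof (m : M) :
  (fun f : dual M => (val f m : R)) \in @dual_pred (R^c : nzRingType) (dual M : lmodType R^c).
Proof. by apply/asboolP. Qed.

Definition to_bidual (m : M) : dual (dual M : lmodType (R^c : nzRingType)) := Dual (bidual_subproof m).

Definition reflexive_module : Prop := bijective to_bidual.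

End Reflexive.

Arguments reflexive_module R M : clear implicits.

Section IdealModules.
Variables (R : nzRingType) (I : set R) (hI : two_sided_ideal I).

Definition left_pred : {pred R^o} := [pred x : R^o | `[< I x >]].
Definition right_pred : {pred (R^c)^o} := [pred x : (R^c)^o | `[< I x >]].

Lemma left_submod_closed : submod_closed left_pred.
Proof.
case: hI => I0 ID Il _; split=> [|a x y /asboolP Ix /asboolP Iy]; apply/asboolP => //.
by apply: ID => //; exact: Il.
Qed.

Lemma right_submod_closed : submod_closed right_pred.
Proof.
case: hI => I0 ID _ Ir; split=> [|a x y /asboolP Ix /asboolP Iy]; apply/asboolP => //.
by apply: ID => //; exact: Ir.
Qed.

Definition left_ideal_mod of two_sided_ideal I := {x : R^o | x \in left_pred}.
Definition right_ideal_mod of two_sided_ideal I := {x : (R^c)^o | x \in right_pred}.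

HB.instance Definition _ := SubChoice.on (left_ideal_mod hI).
HB.instance Definition _ := GRing.SubChoice_isSubLmodule.Build R R^o left_pred
  (left_ideal_mod hI) left_submod_closed.

HB.instance Definition _ := SubChoice.on (right_ideal_mod hI).
HB.instance Definition _ := GRing.SubChoice_isSubLmodule.Build R^c (R^c)^o right_pred
  (right_ideal_mod hI) right_submod_closed.

End IdealModules.

Definition reflexive_ideal (R : nzRingType) (I : set R) : Prop :=
  exists hI : two_sided_ideal I,
    reflexive_module R (left_ideal_mod hI) /\ reflexive_module R^c (right_ideal_mod hI).

Section Derivations.
Variables (A : nzRingType) (F : filtration A) (A1 : subringClosed A).

(* B1, the image of gr A1 in B = gr A *)
Definition gr_image : set (gr F) := range (@gr_incl A F A1).

Definition ad (a x : A) : A := a * x - x * a.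

Lemma ad_zmod_morphism a : zmod_morphism (ad a).
Proof.
move=> x y.
rewrite /ad mulrBr mulrBl !opprB addrACA [RHS]addrACA.
by rewrite [- _ + _]addrC. Qed.

HB.instance Definition _ a :=
  GRing.isZmodMorphism.Build A A (ad a) (ad_zmod_morphism a).

Record source := Source {
  src :> nat -> A;
  theta : nat -> nat;
  theta1 : nat -> nat;
  src_deg : forall r k x, F k x -> F (k - (theta r)%:Z) (ad (src r) x);
  src_deg1 : forall r k x,
    x \in A1 -> F k x -> F (k - (theta1 r)%:Z) (ad (src r) x);
  src_lim : forall M : nat, exists N : nat, forall r : nat,
    (N <= r)%N -> (theta r + M <= theta1 r)%N }.

(* {a_r, -}_theta(a_r) *)
Definition src_bracket (a : source) (r : nat) : gr F -> gr F :=
  gr_map (phi := ad (a r)) (@src_deg a r).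

Definition src_closure (a : source) (I : set (gr F)) : set (gr F) :=
  [set Y | homogeneous Y /\
     exists N : nat, forall r : nat, (N <= r)%N -> I (src_bracket a r Y)].

Definition is_derivation (d : gr F -> gr F) : Prop :=
  [/\ forall x y, d (x + y) = d x + d y,
      forall x y, d (x * y) = d x * y + x * d y &
      forall c x, gr_image c -> d (c * x) = c * d x].

Definition derivation_hypothesis : Prop :=
  forall X Y : gr F, homogeneous X -> homogeneous Y ->
    (forall a : source, src_closure a (principal X) Y) ->
    forall d, is_derivation d -> principal X (d Y).

End Derivations.

(* The last condition is the internal direct sum of the B1 y^alpha: the components c alpha,
   rather than their coefficients in B1, are required to be unique. *)
Definition frobenius_pair (p : nat) (K : fieldType) (A : algType K)
    (F : filtration A) (A1 : subringClosed A) : Prop :=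
  [/\ fil_complete F /\ GRing.scaler_closed A1,
      fil_closed F [set x | x \in A1],
      is_comm_domain (gr F) /\ is_noetherian (gr F),
      forall b : gr F, gr_image A1 (b ^+ p) &
      exists t (y : 'I_t -> gr F),
        [/\ (0 < t)%N, forall i, homogeneous (y i) &
            forall b : gr F, exists! c : {ffun 'I_t -> 'I_p} -> gr F,
              (forall alpha, exists2 b1, gr_image A1 b1 &
                 c alpha = b1 * \prod_i y i ^+ alpha i) /\
              b = \sum_alpha c alpha]].

(* Main.v *)
Require Import Defs.
From HB Require Import structures.
From mathcomp Require Import all_boot all_order all_algebra.
From mathcomp Require Import finmap all_classical.
From mathcomp Require Import ring zify.

(* Let X be the greatest common divisor of gr I in the factorial ring B.  Since
   [a, I] <= I for every a, X lies in the closure of XB for every source of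
   derivations, so XB is stable under Der_B1(B); differentiating coordinates,
   XB = X1 B with X1 in B1.  If w1 + eps lies in I with w1 in A1, then [a_r, w1]
   is negligible for large r, so the symbol of eps is in the closure of XB too
   and hence in B1 + XB.  Correcting w by right multiples, one finds at each
   prime q of B elements of I that are as close as desired to A1 and whose
   symbol is X s with q not dividing s.  Dividing a given v = sum v_k e_k of I
   (e a lift of the basis y^alpha) by such an element shows that each v_k
   belongs to I locally at q.  A reflexive ideal is determined by these local
   conditions, so v_k is in I.  The mirror statement holds in the opposite ring,
   which has the same symbols, and freeness of A over A1 on both sides carries
   reflexivity of I down to the intersection with A1. *)

Set Implicit Arguments.
Unset Strict Implicit.
Unset Printing Implicit Defensive.

Import Order.TTheory GRing.Theory Num.Theory.

Local Open Scope classical_set_scope.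
Local Open Scope ring_scope.

(** * Factorial rings *)

(** The obstacle is that X need not itself be the symbol of an element of I, so there is in general
    no single element to divide by. At a prime q one settles for a symbol X s with q not dividing s,
    and each division then costs a factor s on the dividend. Such a factor is harmless only if it
    comes from A1: left multiplication by an element of A1 acts entrywise on left coordinates, so
    s^k v has coordinates s^k v_k. This is why the starting element is multiplied so that its
    cofactor becomes a p-th power, hence the symbol of an element of A1. Closeness of w = w1 + eps
    to A1 serves a different purpose. For z = sum c_j e_j, the coordinates of w1 z are w1 c_j, and
    these differ from the elements w c_j of I only by eps c_j. Dividing by w therefore produces
    quotient terms whose coordinates are again close to I. What remains, a factor prime to q and an
    error of arbitrarily low degree, is exactly what a reflexive ideal tolerates. *)

Section Factorization.
Variable U : comNzRingType.
Hypothesis U_dom : is_comm_domain U.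

Definition dvd (a b : U) : Prop := exists c, b = a * c.

Definition prime_elt (q : U) : Prop :=
  [/\ q <> 0, ~ is_unit q & forall a b, dvd q (a * b) -> dvd q a \/ dvd q b].

Lemma dom_mulf_eq0 (a b : U) : a * b = 0 -> a <> 0 -> b = 0.
Proof. by move=> /(U_dom.2) []. Qed.

Lemma dom_mulfI (a b c : U) : a <> 0 -> a * b = a * c -> b = c.
Proof.
by move=> a0 /eqP; rewrite -subr_eq0 -mulrBr => /eqP /dom_mulf_eq0 /(_ a0) /subr0_eq.
Qed.

Lemma dvd_refl (a : U) : dvd a a.
Proof. by exists 1; rewrite mulr1. Qed.

Lemma dvd_mulr (a b c : U) : dvd a b -> dvd a (b * c).
Proof. by move=> [d ->]; exists (d * c); rewrite mulrA. Qed.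

Lemma dvd_mull (a b c : U) : dvd a b -> dvd a (c * b).
Proof. by rewrite mulrC; exact: dvd_mulr. Qed.

Lemma dvd0 (a : U) : dvd a 0.
Proof. by exists 0; rewrite mulr0. Qed.

Lemma dvdD (a b c : U) : dvd a b -> dvd a c -> dvd a (b + c).
Proof. by move=> [d ->] [e ->]; exists (d + e); rewrite mulrDr. Qed.

Lemma dvdN (a b : U) : dvd a b -> dvd a (- b).
Proof. by move=> [d ->]; exists (- d); rewrite mulrN. Qed.

Lemma dvdB (a b c : U) : dvd a b -> dvd a c -> dvd a (b - c).
Proof. by move=> ab ac; apply: dvdD => //; apply: dvdN. Qed.

Lemma dvd_sum (a : U) (I : Type) (r : seq I) (P : pred I) (f : I -> U) :
  (forall i, P i -> dvd a (f i)) -> dvd a (\sum_(i <- r | P i) f i).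
Proof. by move=> h; elim/big_ind: _ => //; [exact: dvd0|exact: dvdD]. Qed.

Lemma dvd_trans (a b c : U) : dvd a b -> dvd b c -> dvd a c.
Proof. by move=> [d ->] [e ->]; exists (d * e); rewrite mulrA. Qed.

Lemma principalE (a b : U) : principal a b <-> dvd a b.
Proof. by split=> [[c _ <-]|[c ->]]; exists c. Qed.

(** The number of primes is a parameter because it is the induction measure for cancellation, for
    the obstruction to divisibility and for greatest common divisors. *)
Fixpoint prime_prod (n : nat) (u : U) : Prop :=
  if n is n'.+1 then exists q v, [/\ prime_elt q, u = q * v & prime_prod n' v]
  else is_unit u.

Lemma is_unitM (u v : U) : is_unit u -> is_unit v -> is_unit (u * v).
Proof.
move=> [u' [uu' _]] [v' [vv' _]]; exists (u' * v').
by rewrite [u' * v' * _]mulrC mulrACA uu' vv' mulr1.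
Qed.

Lemma dvd_unit (u v : U) : dvd u v -> is_unit v -> is_unit u.
Proof.
move=> [c ->] [w [cw _]]; exists (c * w); split; first by rewrite mulrA.
by rewrite mulrC mulrA.
Qed.

Lemma prime_prod_unitM n (w u : U) :
  is_unit w -> prime_prod n u -> prime_prod n (w * u).
Proof.
elim: n u => [|n IHn] u wU /=; first exact: is_unitM.
move=> [q [v [qP -> vP]]]; exists q, (w * v); split=> //; last exact: IHn.
by rewrite mulrCA.
Qed.

(** Compare [q] with the leading prime [r]. Either [r] divides [q], the two are associates and the
    connecting unit passes to [u]; or [r] divides [u], and induction removes [q] from the rest. *)
Lemma prime_prod_cancel n (q u : U) :
  prime_prod n (q * u) -> prime_elt q -> exists2 m, n = m.+1 & prime_prod m u.
Proof.
elim: n q u => [|n IHn] q u /=.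
  by move=> qu [_ qU _]; case: qU; apply: dvd_unit qu; exists u.
move=> [r [v [rP quE vP]]] qP; exists n => //.
have [q0 qU qD] := qP; have [r0 _ rD] := rP.
have : dvd r (q * u) by rewrite quE; exists v.
move=> /rD [[c qE]|[w uE]].
  have cU : is_unit c.
    have : dvd q (r * c) by rewrite -qE; exact: dvd_refl.
    move=> /qD [[d rE]|[d cE]].
      exists d; suff : c * d = 1 by move=> h; rewrite [d * c]mulrC.
      by apply: (dom_mulfI q0); rewrite mulr1 {2}qE [in RHS]rE; ring.
    suff : dvd r 1 by move=> [e /esym re]; case: rP => _ []; exists e; rewrite [e * _]mulrC.
    exists d; apply: (dom_mulfI q0); rewrite mulr1 {1}qE [in LHS]cE; ring.
  move: vP; have -> // : v = c * u.
    by apply: (dom_mulfI r0); rewrite -quE {1}qE mulrA.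
  have [d [cd _]] := cU => /(prime_prod_unitM (w := d)).
  rewrite mulrA [d * c]mulrC cd mul1r; apply.
  by exists c; rewrite [d * c]mulrC.
have vE : v = q * w by apply: (dom_mulfI r0); rewrite -quE uE; ring.
move: vP; rewrite vE => vP; have [m nE mP] := IHn _ _ vP qP.
by rewrite nE uE /=; exists r, w.
Qed.

(* If z does not divide c, cancel from both all common prime factors of z:
   a prime of z dividing no further into c is the obstruction. *)
Lemma prime_prod_obstruction n (z c : U) : prime_prod n z -> ~ dvd z c ->
  exists2 q, prime_elt q & forall s, ~ dvd q s -> ~ dvd z (c * s).
Proof.
elim: n z c => [|n IHn] z c /=.
  move=> [v [zv _]] []; exists (v * c); by rewrite mulrA zv mul1r.
move=> [q [v [qP -> vP]]] nzc; have [q0 _ qD] := qP.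
have [[d cE]|nqc] := pselect (dvd q c).
  have nvd : ~ dvd v d by move=> [e dE]; apply: nzc; exists e; rewrite cE dE mulrA.
  have [r rP rs] := IHn _ _ vP nvd; exists r => // s /rs ns [e].
  by rewrite cE -!mulrA => /(dom_mulfI q0) h; apply: ns; exists e.
exists q => // s nqs [e csE].
by have /qD [] : dvd q (c * s) by rewrite csE -mulrA; exists (v * e).
Qed.

Definition prime_factorial : Prop := forall u : U, u <> 0 -> exists n, prime_prod n u.

Definition coprime_set (G : set U) : Prop :=
  forall q, prime_elt q -> exists2 u, G u & ~ dvd q u.

(** If [z] does not divide [c], the failure is visible at one prime, and multiplying by a member of
    [G] prime to it cannot repair the failure. *)
Lemma coprime_set_dvd (G : set U) (z c : U) : prime_factorial -> coprime_set G ->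
  z <> 0 -> (forall u, G u -> dvd z (c * u)) -> dvd z c.
Proof.
move=> fac Gco /fac [n zP] zG; apply: contrapT => /(prime_prod_obstruction zP) [q qP qs].
by have [u Gu /qs] := Gco q qP; apply; exact: zG.
Qed.

(** Dividing all of [G] by a common prime lowers the number of prime factors of one fixed nonzero
    member, so this can be repeated only finitely often. *)
Lemma gcd_exists (G : set U) : prime_factorial -> (exists2 u, G u & u <> 0) ->
  exists2 g, g <> 0 & (forall u, G u -> dvd g u) /\ coprime_set [set v | G (g * v)].
Proof.
move=> fac [u Gu u0]; have [n uP] := fac u u0.
elim: n G u uP Gu {u0} => [|n IHn] G u uP Gu.
  exists 1; first by move/eqP; rewrite oner_eq0.
  split=> [v _|q [_ qU _]]; first by exists v; rewrite mul1r.
  by exists u => /=; rewrite ?mul1r // => /dvd_unit /(_ uP).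
have [[q qP Gq]|noq] := pselect (exists2 q, prime_elt q & forall v, G v -> dvd q v).
  have [v uE] := Gq u Gu; move: uP; rewrite uE => uP.
  have [_ [<-] vP] := prime_prod_cancel uP qP.
  have [|g g0 [gG gco]] := IHn [set v | G (q * v)] v vP; first by rewrite /= -uE.
  have [q0 _ _] := qP; exists (q * g); first by move=> /dom_mulf_eq0 /(_ q0).
  split=> [w Gw|r rP].
    have [x wE] := Gq w Gw; have [|y xE] := gG x; first by rewrite /= -wE.
    by exists y; rewrite wE xE mulrA.
  by have [x Gx nx] := gco r rP; exists x => //=; rewrite -mulrA.
exists 1; first by move/eqP; rewrite oner_eq0.
split=> [v _|q qP]; first by exists v; rewrite mul1r.
apply: contrapT => nG; apply: noq; exists q => // v Gv; apply: contrapT => nqv.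
by apply: nG; exists v => //=; rewrite mul1r.
Qed.

End Factorization.

Section UniqueFactorization.
Variable U : comNzRingType.
Hypothesis ufd : is_ufd U.

Let U_dom : is_comm_domain U.
Proof. by case: ufd. Qed.

Lemma ufd_factor (x : U) : x <> 0 -> ~ is_unit x ->
  exists2 s : seq U, (forall y, y \in s -> is_irreducible y) & x = \prod_(y <- s) y.
Proof.
move=> x0 xU; have [_ /(_ x x0 xU) [n [s [sI ->]]] _] := ufd.
exists [seq s i | i <- enum 'I_n]; last by rewrite big_map big_enum.
by move=> y /mapP[i _ ->].
Qed.

Lemma ufd_uniq_factor (s t : seq U) (x : U) :
  (forall y, y \in s -> is_irreducible y) -> (forall y, y \in t -> is_irreducible y) ->
  \prod_(y <- s) y = \prod_(y <- t) y -> x \in s -> exists2 y, y \in t & dvd x y.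
Proof.
move=> sI tI st xs; have [_ _ uniq_fac] := ufd.
have [] := uniq_fac (size s) (size t) (fun i => s`_i) (fun i => t`_i).
- by move=> i; apply: sI; rewrite mem_nth.
- by move=> i; apply: tI; rewrite mem_nth.
- by move: st; rewrite (big_nth 0) big_mkord => ->; rewrite (big_nth 0) big_mkord.
move=> f _ fP; have xi : (index x s < size s)%N by rewrite index_mem.
have [u _ fE] := fP (Ordinal xi); exists (t`_(f (Ordinal xi))); first by rewrite mem_nth.
by rewrite fE /= nth_index //; exists u; rewrite mulrC.
Qed.

Lemma irreducible_mulU (x c : U) : is_irreducible x -> is_unit c -> is_irreducible (x * c).
Proof.
move=> [x0 xU xI] cU; have [c' [cc' _]] := cU.
have xE : x = x * c * c' by rewrite -mulrA cc' mulr1.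
split=> [xc0|xcU|a b abE].
- by apply: x0; rewrite xE xc0 mul0r.
- by apply: xU; apply: dvd_unit xcU; exists c.
- have [aU|/(is_unitM cU)] : is_unit a \/ is_unit (b * c').
  + by apply: xI; rewrite mulrA -abE.
  + by left.
  by rewrite mulrCA cc' mulr1; right.
Qed.

Lemma irreducible_prime (x : U) : is_irreducible x -> prime_elt x.
Proof.
move=> xI; have [x0 xU xD] := xI; split=> // a b [c abE].
have [a0|a0] := pselect (a = 0); first by left; rewrite a0; exact: dvd0.
have [b0|b0] := pselect (b = 0); first by right; rewrite b0; exact: dvd0.
have unit_case d e : d * e = x * c -> is_unit d -> dvd x e.
  move=> deE [d' [dd' _]]; exists (c * d').
  by rewrite mulrA -deE mulrAC dd' mul1r.
have [aU|aU] := pselect (is_unit a); first by right; apply: unit_case aU.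
have [bU|bU] := pselect (is_unit b).
  by left; apply: unit_case bU; rewrite mulrC.
have [s sI aE] := ufd_factor a0 aU; have [t tI bE] := ufd_factor b0 bU.
have stI y : y \in s ++ t -> is_irreducible y.
  by rewrite mem_cat => /orP [/sI|/tI].
have stE : \prod_(y <- s ++ t) y = x * c by rewrite big_cat /= -aE -bE.
(* This factorization of [x * c] starts with a multiple of [x]. A unit [c] has to be absorbed into
   that factor, because factorizations consist of irreducibles only. *)
have [z [zI xz [r rI rE]]] : exists z, [/\ is_irreducible z, dvd x z &
    exists2 r : seq U, (forall y, y \in r -> is_irreducible y) &
      x * c = \prod_(y <- z :: r) y].
  have [cU|cU] := pselect (is_unit c).
    exists (x * c); split; [exact: irreducible_mulU|by exists c|].
    by exists [::] => //; rewrite big_seq1.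
  have c0 : c <> 0.
    by move=> c0; move: abE; rewrite c0 mulr0 => /(dom_mulf_eq0 U_dom) /(_ a0) /b0.
  have [r rI cE] := ufd_factor c0 cU.
  exists x; split=> //; first exact: dvd_refl.
  by exists r => //; rewrite big_cons -cE.
have [|||y] := @ufd_uniq_factor (z :: r) (s ++ t) z _ stI.
- by move=> y; rewrite inE => /predU1P [->|/rI].
- by rewrite stE rE.
- by rewrite inE eqxx.
rewrite mem_cat => /orP [ys|yt] /(dvd_trans xz) xy; [left|right].
  by rewrite aE (big_rem y ys); exact: dvd_mulr.
by rewrite bE (big_rem y yt); exact: dvd_mulr.
Qed.

Lemma ufd_prime_factorial : prime_factorial U.
Proof.
move=> x x0; have [xU|xU] := pselect (is_unit x); first by exists 0%N.
have [s sI ->] := ufd_factor x0 xU; exists (size s).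
elim: s sI => [|y s IHs] sI; first by rewrite big_nil; exists 1; rewrite mulr1.
rewrite big_cons /=; exists y, (\prod_(z <- s) z); split=> //.
  by apply: irreducible_prime; apply: sI; rewrite inE eqxx.
by apply: IHs => z zs; apply: sI; rewrite inE zs orbT.
Qed.

End UniqueFactorization.

(** * Complete filtered rings and symbols *)

Section Completeness.
Variables (A : nzRingType) (F : filtration A).

Lemma fil_eq0 (n : int) (x : A) : (forall k : nat, F (n - k%:Z) x) -> x = 0.
Proof.
move=> Fx; suff : (\bigcap_m fil F m) x by rewrite fil_separated.
by move=> m _; apply: (fil_le _ (Fx `|n - m|%N)); lia.
Qed.

Lemma fil_neg (x : A) : x <> 0 -> exists n, ~ F n x.
Proof.
move=> x0; apply: contrapT => h; apply: x0; apply: (@fil_eq0 0) => k.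
by apply: contrapT => nF; apply: h; exists (0 - k%:Z).
Qed.

Lemma fil_ex (x : A) : exists n, F n x.
Proof.
by have : (\bigcup_n fil F n) x; [rewrite fil_exhaustive|move=> [n _ Fx]; exists n].
Qed.

Lemma fil_degree (x : A) : x <> 0 -> exists2 n, F n x & ~ F (n - 1) x.
Proof.
move=> /fil_neg [m nFm]; have [n Fn] := fil_ex x.
pose P k := `[< F (m + k%:Z) x >].
have exP : exists k, P k.
  by exists `|n - m|%N; apply/asboolP; apply: (fil_le _ Fn); lia.
case: (ex_minnP exP) => -[|k] /asboolP Fk kmin.
  by case: nFm; rewrite addr0 in Fk.
exists (m + k.+1%:Z) => // Fk'; have : P k.
  by apply/asboolP; apply: (fil_le _ Fk'); lia.
by move/kmin; rewrite ltnn.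
Qed.

Lemma closed_cvg (C : set A) (u : nat -> A) (l : A) :
  fil_closed F C -> (forall i, C (u i)) -> fil_cvg F u l -> C l.
Proof.
move=> Ccl Cu ul; apply: contrapT => nCl; have [n nC] := Ccl l nCl.
by have [N uN] := ul n; apply: (nC (u N)); [exact: uN|exact: Cu].
Qed.

(* Successive approximation: completeness upgrades division with remainder of
   smaller degree to exact division. *)
Lemma approx_sum (J : finType) (l : J -> A) (d : J -> int) (C Q : set A) :
  fil_complete F -> fil_closed F C -> C 0 ->
  (forall x y, C x -> C y -> C (x + y)) -> (forall j, F (d j) (l j)) ->
  (forall n x, Q x -> F n x -> exists c : J -> A,
     [/\ forall j, C (c j), forall j, F (n - d j) (c j),
         Q (x - \sum_j c j * l j) & F (n - 1) (x - \sum_j c j * l j)]) ->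
  forall n x, Q x -> F n x -> exists c : J -> A,
     [/\ forall j, C (c j), forall j, F (n - d j) (c j) & x = \sum_j c j * l j].
Proof.
move=> Fcpl Ccl C0 CD Fl step n x Qx Fx.
have [f fP] : exists f : int -> A -> J -> A, forall n x, Q x -> F n x ->
    [/\ forall j, C (f n x j), forall j, F (n - d j) (f n x j),
        Q (x - \sum_j f n x j * l j) & F (n - 1) (x - \sum_j f n x j * l j)].
  have h (u : int * A) : exists c : J -> A, Q u.2 -> F u.1 u.2 ->
    [/\ forall j, C (c j), forall j, F (u.1 - d j) (c j),
        Q (u.2 - \sum_j c j * l j) & F (u.1 - 1) (u.2 - \sum_j c j * l j)].
    have [[Qu Fu]|nQF] := pselect (Q u.2 /\ F u.1 u.2).
      by have [c cP] := step _ _ Qu Fu; exists c.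
    by exists (fun=> 0) => Qu Fu; case: nQF.
  by have [g gP] := choice h; exists (fun n x => g (n, x)) => m y; exact: (gP (m, y)).
pose X := fix X k := if k is k'.+1 then
  X k' - \sum_j f (n - k'%:Z) (X k') j * l j else x.
pose c k j := f (n - k%:Z) (X k) j.
have XP k : Q (X k) /\ F (n - k%:Z) (X k).
  elim: k => [|k [QX FX]]; first by rewrite subr0.
  have [_ _ QX' FX'] := fP _ _ QX FX; split=> //=.
  by rewrite (_ : n - k.+1%:Z = n - k%:Z - 1) //; lia.
have cP k j : C (c k j) /\ F (n - k%:Z - d j) (c k j).
  by have [QX FX] := XP k; have [Cf Ff _ _] := fP _ _ QX FX; split; [exact: Cf|exact: Ff].
pose S k j := \sum_(i < k) c i j.
have SS k : S k.+1 = fun j => S k j + c k j.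
  by apply/funext => j; rewrite /S big_ord_recr.
have XE k : X k = x - \sum_j S k j * l j.
  elim: k => [|k IHk].
    by rewrite big1 ?subr0 // => j _; rewrite /S big_ord0 mul0r.
  rewrite /= {1}IHk SS -addrA -opprD -big_split /=; congr (_ - _).
  by apply: eq_bigr => j _; rewrite mulrDl.
have SF k m j : (k <= m)%N -> F (n - k%:Z - d j) (S m j - S k j).
  move=> /subnKC <-; elim: (m - k)%N => [|i IHi].
    by rewrite addn0 subrr; exact: fil0.
  rewrite addnS SS /= [S _ j + _ - _]addrAC; apply: filD => //.
  by have [_ cF] := cP (k + i)%N j; apply: (fil_le _ cF); lia.
have [L LP] : exists L : J -> A, forall j, fil_cvg F (S ^~ j) (L j).
  suff h j : exists z, fil_cvg F (S ^~ j) z by have [L LP] := choice h; exists L.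
  apply: Fcpl => m; exists (absz (n - d j - m)%R) => i k iN kN.
  have [ik|/ltnW ki] := leqP i k.
    by rewrite -opprB; apply: filN; apply: (fil_le _ (SF _ _ j ik)); lia.
  by apply: (fil_le _ (SF _ _ j ki)); lia.
have LS k j : F (n - k%:Z - d j) (L j - S k j).
  have [N NP] := LP j (n - k%:Z - d j).
  rewrite (_ : L j - S k j = (S (maxn N k) j - S k j) - (S (maxn N k) j - L j)).
    by apply: filB; [apply: SF; rewrite leq_maxr|apply: NP; rewrite leq_maxl].
  by rewrite opprB [RHS]addrC addrA subrK.
exists L; split=> [j|j|].
- apply: closed_cvg (LP j) => // i; rewrite /S.
  by elim/big_ind: _ => // k _; have [] := cP k j.
- by have := LS 0%N j; rewrite /S big_ord0 !subr0.
apply/eqP; rewrite -subr_eq0; apply/eqP; apply: (@fil_eq0 n) => k.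
have [_ FX] := XP k.
rewrite (_ : x - _ = X k - \sum_j (L j - S k j) * l j); last first.
  rewrite XE -addrA -opprD -big_split /=; congr (_ - _).
  by apply: eq_bigr => j _; rewrite -mulrDl addrC subrK.
apply: filB => //; apply: fil_sum => j _.
by rewrite (_ : n - k%:Z = n - k%:Z - d j + d j); [exact: filM|rewrite subrK].
Qed.

End Completeness.

(* The part of the associated graded ring seen by the argument.  As B is
   commutative, a symbol map for A is also one for the opposite ring. *)
Record symbol_map (A : nzRingType) (F : filtration A) (B : comNzRingType) := SymbolMap {
  sy :> int -> A -> B;
  sy1 : sy 0 1 = 1;
  syB : forall n x y, F n x -> F n y -> sy n (x - y) = sy n x - sy n y;
  syM : forall n m x y, F n x -> F m y -> sy n x * sy m y = sy (n + m) (x * y);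
  sy_eq0 : forall n x, F n x -> sy n x = 0 <-> F (n - 1) x;
  hcomp : int -> {additive B -> B};
  hcomp_sy : forall n m x, F n x -> hcomp m (sy n x) = if m == n then sy n x else 0;
  hcomp_ex : forall n b, exists2 x, F n x & hcomp n b = sy n x;
  hcomp_sum : forall b, exists2 s : seq int, uniq s & b = \sum_(n <- s) hcomp n b }.

Section SymbolTheory.
Variables (A : nzRingType) (F : filtration A) (B : comNzRingType).
Variable S : symbol_map F B.
Hypothesis B_dom : is_comm_domain B.

Definition homog (b : B) : Prop := exists n x, F n x /\ b = S n x.

Lemma sy0 n : S n 0 = 0.
Proof. by apply/sy_eq0; exact: fil0. Qed.

Lemma syD n x y : F n x -> F n y -> S n (x + y) = S n x + S n y.
Proof.
move=> Fx Fy; rewrite -[y in LHS]opprK syB //; last exact: filN.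
by rewrite -[- y]sub0r syB ?sy0 ?sub0r ?opprK //; exact: fil0.
Qed.

Lemma sy_sum n (I : Type) (r : seq I) (P : pred I) (f : I -> A) :
  (forall i, P i -> F n (f i)) ->
  S n (\sum_(i <- r | P i) f i) = \sum_(i <- r | P i) S n (f i).
Proof.
move=> Ff; elim: r => [|i r IHr]; first by rewrite !big_nil sy0.
rewrite !big_cons; case: ifP => // Pi.
by rewrite syD ?IHr //; [exact: Ff|exact: fil_sum].
Qed.

Lemma sy_eq n x y : F n x -> F n y -> S n x = S n y -> F (n - 1) (x - y).
Proof. by move=> Fx Fy xy; apply/(sy_eq0 S); [exact: filB|rewrite syB // xy subrr]. Qed.

Lemma sy_degree (x : A) : x <> 0 -> exists2 n, F n x & S n x <> 0.
Proof. by move=> /(fil_degree F) [n Fx nFx]; exists n => // /(sy_eq0 S Fx). Qed.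

Lemma hcomp_syE n x : F n x -> hcomp S n (S n x) = S n x.
Proof. by move=> Fx; rewrite hcomp_sy // eqxx. Qed.

Lemma hcomp_comp n m b : hcomp S m (hcomp S n b) = if m == n then hcomp S n b else 0.
Proof. by have [x Fx ->] := hcomp_ex S n b; rewrite hcomp_sy. Qed.

Lemma hcompM n b c : exists2 s : seq int, uniq s &
  b = \sum_(m <- s) hcomp S m b /\
  hcomp S n (b * c) = \sum_(m <- s) hcomp S m b * hcomp S (n - m) c.
Proof.
have [s us bE] := hcomp_sum S b; exists s => //; split=> //.
rewrite {1}bE mulr_suml raddf_sum; apply: eq_bigr => m _.
have [x Fx ->] := hcomp_ex S m b.
have [t ut cE] := hcomp_sum S c; rewrite cE mulr_sumr !raddf_sum mulr_sumr.
apply: eq_bigr => k _; have [y Fy ->] := hcomp_ex S k c.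
rewrite syM // !hcomp_sy //; last exact: filM.
by rewrite subr_eq [m + k]addrC; case: eqP; rewrite ?mulr0 // => _; rewrite syM // addrC.
Qed.

Lemma hcomp_mul_sy n m b x : F m x -> hcomp S n (b * S m x) = hcomp S (n - m) b * S m x.
Proof.
move=> Fx; rewrite mulrC; have [s us [xE ->]] := hcompM n (S m x) b.
rewrite mulrC [in RHS]xE mulr_suml; apply: eq_bigr => k _.
by rewrite hcomp_sy //; case: eqP => [->//|_]; rewrite !mul0r.
Qed.

Lemma hcomp_notin b (s : seq int) n :
  b = \sum_(k <- s) hcomp S k b -> n \notin s -> hcomp S n b = 0.
Proof.
move=> bE ns; rewrite bE raddf_sum big1_seq // => k /= ks; rewrite hcomp_comp.
by case: eqP => // nk; rewrite nk ks in ns.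
Qed.

Lemma hcomp_neq0 b : b <> 0 -> exists n, hcomp S n b <> 0.
Proof.
move=> b0; apply: contrapT => h; apply: b0; have [s us ->] := hcomp_sum S b.
by rewrite big1_seq // => k _; apply: contrapT => kb; apply: h; exists k.
Qed.

Lemma hcomp_bounded b : exists N : nat, forall n, hcomp S n b <> 0 -> (absz n <= N)%N.
Proof.
have [s us bE] := hcomp_sum S b; exists (\sum_(k <- s) absz k)%N => n nb.
have ns : n \in s by apply: contrapT => /negP /(hcomp_notin bE).
by rewrite (big_rem _ ns) leq_addr.
Qed.

Lemma hcomp_top b : b <> 0 ->
  exists2 m, hcomp S m b <> 0 & forall n, m < n -> hcomp S n b = 0.
Proof.
move=> /hcomp_neq0 [m0 m0b]; have [N bN] := hcomp_bounded b.
pose P k := `[< hcomp S (m0 + k%:Z) b <> 0 >].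
have exP : exists k, P k by exists 0%N; apply/asboolP; rewrite addr0.
have Pb k : P k -> (k <= N + absz m0)%N by move=> /asboolP /bN; lia.
case: (ex_maxnP exP Pb) => k /asboolP kb kmax; exists (m0 + k%:Z) => // n kn.
apply: contrapT => nb; have : P (absz (n - m0)%R).
  by apply/asboolP; rewrite (_ : m0 + _ = n) //; lia.
by move/kmax; lia.
Qed.

Lemma hcomp_bot b : b <> 0 ->
  exists2 m, hcomp S m b <> 0 & forall n, n < m -> hcomp S n b = 0.
Proof.
move=> /hcomp_neq0 [m0 m0b]; have [N bN] := hcomp_bounded b.
pose P k := `[< hcomp S (m0 - k%:Z) b <> 0 >].
have exP : exists k, P k by exists 0%N; apply/asboolP; rewrite subr0.
have Pb k : P k -> (k <= N + absz m0)%N by move=> /asboolP /bN; lia.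
case: (ex_maxnP exP Pb) => k /asboolP kb kmax; exists (m0 - k%:Z) => // n kn.
apply: contrapT => nb; have : P (absz (n - m0)%R).
  by apply/asboolP; rewrite (_ : m0 - _ = n) //; lia.
by move/kmax; lia.
Qed.

Lemma hcompM_extremal n m b c :
  (forall k, k <> m -> hcomp S k b = 0 \/ hcomp S (n - k) c = 0) ->
  hcomp S n (b * c) = hcomp S m b * hcomp S (n - m) c.
Proof.
move=> h; have [s us [bE ->]] := hcompM n b c.
have z k : k != m -> hcomp S k b * hcomp S (n - k) c = 0.
  by move=> /eqP /h [->|->]; rewrite ?mul0r ?mulr0.
have [ms|ms] := boolP (m \in s).
  rewrite (bigD1_seq m) //= big1 ?addr0 //.
rewrite big1_seq => [|k /= ks]; last by apply: z; apply: contraNneq ms => <-.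
by rewrite (hcomp_notin bE ms) mul0r.
Qed.

(** In a domain the top components of [b] and of its cofactor have a nonzero product, and so do the
    bottom ones. Both products are components of [c], which has a single degree, so the top and
    bottom degrees of [b] coincide. *)
Lemma homog_dvd b c : homog c -> c <> 0 -> dvd b c -> homog b.
Proof.
move=> [n [x [Fx cE]]] c0 [d cbd].
have b0 : b <> 0 by move=> b0; apply: c0; rewrite cbd b0 mul0r.
have d0 : d <> 0 by move=> d0; apply: c0; rewrite cbd d0 mulr0.
have [m mb mtop] := hcomp_top b0; have [m' mb' mbot] := hcomp_bot b0.
have [k kd ktop] := hcomp_top d0; have [k' kd' kbot] := hcomp_bot d0.
have mm' : m' <= m by rewrite leNgt; apply/negP => /mtop.
have kk' : k' <= k by rewrite leNgt; apply/negP => /ktop.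
have top : hcomp S (m + k) c <> 0.
  rewrite cbd (@hcompM_extremal _ m) => [|j jm].
    by rewrite (addrC m) addrK => /(dom_mulf_eq0 B_dom) /(_ mb).
  have [mj|jm'] := ltP m j; first by left; exact: mtop.
  by right; apply: ktop; lia.
have bot : hcomp S (m' + k') c <> 0.
  rewrite cbd (@hcompM_extremal _ m') => [|j jm].
    by rewrite (addrC m') addrK => /(dom_mulf_eq0 B_dom) /(_ mb').
  have [mj|jm'] := ltP j m'; first by left; exact: mbot.
  by right; apply: kbot; lia.
have topE : m + k = n by move: top; rewrite cE hcomp_sy //; case: eqP.
have botE : m' + k' = n by move: bot; rewrite cE hcomp_sy //; case: eqP.
have mm : m = m' by lia.
have [y Fy yE] := hcomp_ex S m b; exists m, y; split=> //.
have [s us bE] := hcomp_sum S b; rewrite -yE {1}bE.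
have [ms|ms] := boolP (m \in s).
  rewrite (bigD1_seq m) //= big1 ?addr0 // => j jm.
  by have [/mtop //|jm'] := ltP m j; apply: mbot; lia.
by case: mb; exact: hcomp_notin bE ms.
Qed.

End SymbolTheory.

(** * Noetherianity, the Ore condition and division, lifted from gr A to A *)

Section Noetherian.
Variables (A : nzRingType) (F : filtration A) (B : comNzRingType).
Variable S : symbol_map F B.
Hypothesis F_complete : fil_complete F.

Lemma closed_setT : fil_closed F setT.
Proof. by move=> x /(_ I). Qed.

Lemma hcomp_sum_subset (b : B) (s t : seq int) : uniq s -> uniq t -> {subset s <= t} ->
  b = \sum_(k <- s) hcomp S k b -> b = \sum_(k <- t) hcomp S k b.
Proof.
move=> us ut st bE; rewrite (bigID (mem s)) /= [X in _ + X]big1 => [|k ks]; last first.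
  exact: hcomp_notin ks.
rewrite addr0 -big_filter {1}bE; apply: perm_big; apply: uniq_perm => //.
  exact: filter_uniq.
by move=> k; rewrite mem_filter /=; case: (boolP (k \in s)) => //= /st ->.
Qed.

Lemma left_noetherian (L : set A) : is_noetherian B ->
  L 0 -> (forall x y, L x -> L y -> L (x + y)) -> (forall a x, L x -> L (a * x)) ->
  exists (J : finType) (l : J -> A), (forall j, L (l j)) /\
    forall x, L x -> exists c : J -> A, x = \sum_j c j * l j.
Proof.
move=> Bnoeth L0 LD LM.
have L_sum (I : Type) (r : seq I) (f : I -> A) :
    (forall i, L (f i)) -> L (\sum_(i <- r) f i).
  by move=> Lf; elim/big_ind: _.
(* This is gr L. It is described through components because [B] is an ungraded ring here and
   elements of the ideal need not be homogeneous. *)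
pose G : set B := [set b | forall m, exists2 x, L x & F m x /\ hcomp S m b = S m x].
have GM b g : G g -> G (b * g).
  move=> Gg m; have [s _ [_ ->]] := hcompM S m b g.
  have h k : exists2 x, L x & F m x /\ hcomp S k b * hcomp S (m - k) g = S m x.
    have [x Fx ->] := hcomp_ex S k b; have [y Ly [Fy ->]] := Gg (m - k).
    exists (x * y); first exact: LM.
    by rewrite syM // subrKC; split=> //; rewrite -(subrKC k m); exact: filM.
  have [f fP] : exists f : int -> A, forall k, L (f k) /\ F m (f k) /\
      hcomp S k b * hcomp S (m - k) g = S m (f k).
    suff h' k : exists x, L x /\ F m x /\ hcomp S k b * hcomp S (m - k) g = S m x.
      by have [f fP] := choice h'; exists f.
    by have [x Lx [Fx xE]] := h k; exists x.
  exists (\sum_(k <- s) f k); first by apply: L_sum => k; have [] := fP k.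
  split; first by apply: fil_sum => k _; have [_ []] := fP k.
  rewrite sy_sum; last by move=> k _; have [_ []] := fP k.
  by apply: eq_bigr => k _; have [_ []] := fP k.
have Gid : two_sided_ideal G.
  split=> [m|b g Gb Gg m|b g Gg|b g Gg].
  - by exists 0 => //; split; [exact: fil0|rewrite raddf0 sy0].
  - have [x Lx [Fx xE]] := Gb m; have [y Ly [Fy yE]] := Gg m.
    exists (x + y); first exact: LD.
    by split; [exact: filD|rewrite raddfD xE yE syD].
  - exact: GM.
  - by rewrite mulrC; exact: GM.
have [N [g GE]] := Bnoeth G Gid.
have Gg i : G (g i).
  rewrite GE; exists (fun j => (j == i)%:R) => //.
  rewrite (bigD1 i) //= eqxx mul1r big1 ?addr0 // => j /negPf ->.
  by rewrite mul0r.
have [t tP] : exists t : seq int, forall i, g i = \sum_(k <- t) hcomp S k (g i).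
  have h i : exists s : seq int, uniq s /\ g i = \sum_(k <- s) hcomp S k (g i).
    by have [s us gE] := hcomp_sum S (g i); exists s.
  have [s sP] := choice h; exists (undup (flatten [seq s i | i <- enum 'I_N])) => i.
  have [us gE] := sP i; apply: hcomp_sum_subset gE => //; first exact: undup_uniq.
  move=> k ks; rewrite mem_undup; apply/flattenP; exists (s i) => //.
  by apply: map_f; rewrite mem_enum.
(* The generators of [G] are replaced by their homogeneous components, which can be lifted to [L];
   [t] is one list of degrees that serves all generators. *)
pose J : finType := ('I_N * 'I_(size t))%type; pose d (j : J) : int := t`_j.2.
have [l lP] : exists l : J -> A, forall j, [/\ L (l j), F (d j) (l j) &
    hcomp S (d j) (g j.1) = S (d j) (l j)].
  suff h (j : J) : exists x, [/\ L x, F (d j) x & hcomp S (d j) (g j.1) = S (d j) x].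
    by have [l lP] := choice h; exists l.
  by have [x Lx [Fx xE]] := Gg j.1 (d j); exists x.
exists J, l; split=> [j|x Lx]; first by have [] := lP j.
have [n Fx] := fil_ex F x.
suff /(_ n x Lx Fx) [c [_ _ ->]] : forall n x, L x -> F n x -> exists c : J -> A,
    [/\ forall j, setT (c j), forall j, F (n - d j) (c j) & x = \sum_j c j * l j].
  by exists c.
apply: approx_sum F_complete closed_setT _ _ _ _ => // [j|{n x Lx Fx}n x Lx Fx].
  by have [] := lP j.
have : G (S n x).
  move=> m; rewrite hcomp_sy //; case: eqP => [->|_]; first by exists x.
  by exists 0 => //; split; [exact: fil0|rewrite sy0].
rewrite GE => -[b _ bE].
have h (j : J) : exists z, F (n - d j) z /\ hcomp S (n - d j) (b j.1) = S (n - d j) z.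
  by have [z Fz zE] := hcomp_ex S (n - d j) (b j.1); exists z.
have [c cP] := choice h.
have Fcl j : F n (c j * l j).
  by have [Fc _] := cP j; have [_ Fl _] := lP j; rewrite -(subrK (d j) n); exact: filM.
exists c; split=> // [j||]; first by have [] := cP j.
  by rewrite -sumrN; apply: LD => //; apply: L_sum => j; rewrite -mulNr; apply: LM; have [] := lP j.
apply: (sy_eq (S := S) Fx); first by apply: fil_sum.
rewrite sy_sum // -(hcomp_syE S Fx) -bE raddf_sum.
transitivity (\sum_i \sum_k S n (c (i, k) * l (i, k))); last first.
  by rewrite pair_bigA; apply: eq_bigr => -[].
apply: eq_bigr => i _; rewrite {1}(tP i) mulr_sumr raddf_sum (big_nth 0) big_mkord.
apply: eq_bigr => k _; have [Fc cE] := cP (i, k); have [_ Fl lE] := lP (i, k).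
by rewrite [hcomp S _ (g i)]lE hcomp_mul_sy // cE syM // subrK.
Qed.

(** The left ideal generated by all c a^i is finitely generated, so some c a^n is a left combination
    of earlier terms. In a shortest such relation, separating the term i = 0 leaves z a = r_0 c, and
    z = 0 would give a shorter relation. *)
Lemma left_ore : is_noetherian B -> forall a c : A, c <> 0 ->
  exists r r', r <> 0 /\ r * a = r' * c.
Proof.
move=> Bnoeth a c c0.
pose L n : set A := [set x | exists r : nat -> A, x = \sum_(i < n) r i * (c * a ^+ i)].
have rel n : L n (c * a ^+ n) -> exists r r', r <> 0 /\ r * a = r' * c.
  elim: n => [|n IHn] [r rE].
    by case: c0; move: rE; rewrite big_ord0 expr0 mulr1.
  pose z := c * a ^+ n - \sum_(i < n) r i.+1 * (c * a ^+ i).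
  have [z0|z0] := pselect (z = 0).
    by apply: IHn; exists (r \o succn); apply/subr0_eq.
  exists z, (r 0%N); split=> //; rewrite /z mulrBl -mulrA -exprSr rE big_ord_recl.
  rewrite expr0 mulr1 mulr_suml /= -addrA (eq_bigr (fun i : 'I_n => r i.+1 * (c * a ^+ i) * a)).
    by rewrite subrr addr0.
  by move=> i _; rewrite -!mulrA -exprSr.
have LS n m x : (n <= m)%N -> L n x -> L m x.
  move=> nm [r ->]; exists (fun i => if (i < n)%N then r i else 0).
  rewrite [RHS](bigID (fun i : 'I_m => (i < n)%N)) /= [X in _ + X]big1 ?addr0; last first.
    by move=> i /negPf ->; rewrite mul0r.
  rewrite [LHS](big_ord_widen m (fun i => r i * (c * a ^+ i))) //.
  by apply: eq_bigr => i ->.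
have LD n x y : L n x -> L n y -> L n (x + y).
  move=> [r ->] [s ->]; exists (fun i => r i + s i); rewrite -big_split /=.
  by apply: eq_bigr => i _; rewrite mulrDl.
have LM n b x : L n x -> L n (b * x).
  move=> [r ->]; exists (fun i => b * r i); rewrite mulr_sumr.
  by apply: eq_bigr => i _; rewrite mulrA.
have L0 n : L n 0 by exists (fun=> 0); rewrite big1 // => i _; rewrite mul0r.
have [|x y [n nx] [m my]|b x [n nx]|J [l [lL lP]]] :=
  @left_noetherian [set x | exists n, L n x] Bnoeth.
- by exists 0%N.
- exists (maxn n m); apply: LD; [apply: LS nx|apply: LS my].
    exact: leq_maxl.
  exact: leq_maxr.
- by exists n; exact: LM.
have [f fP] := choice lL; pose n := \max_j f j.
apply: (rel n); have [|c' ->] := lP (c * a ^+ n).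
  by exists n.+1, (fun i => (i == n)%:R); rewrite big_ord_recr /= eqxx mul1r big1 ?add0r // => i _;
     rewrite ltn_eqF ?mul0r.
elim/big_ind: _ => // [x y Lx Ly|j _]; first exact: LD.
by apply: LM; apply: LS (fP j); exact: leq_bigmax.
Qed.

(** If the symbol of every remainder were divisible by that of [b], the degree of the remainder
    could always be lowered, and completeness would turn the successive corrections into an exact
    quotient. *)
Lemma left_division (b : A) (m : int) (y : A) : F m b ->
  (exists q, y = q * b) \/
  exists q k, F k (y - q * b) /\ ~ dvd (S m b) (S k (y - q * b)).
Proof.
move=> Fb; have [[q [k qk]]|noqk] := pselect (exists q k, F k (y - q * b) /\
    ~ dvd (S m b) (S k (y - q * b))); first by right; exists q, k.
left; have [n Fy] := fil_ex F y.
pose Q : set A := [set x | exists q, x = y - q * b].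
suff /(_ n y) : forall n x, Q x -> F n x -> exists c : unit -> A,
    [/\ forall j, setT (c j), forall j, F (n - m) (c j) & x = \sum_j c j * b].
  case=> // [|c [_ _ ->]]; first by exists 0; rewrite mul0r subr0.
  by exists (c tt); rewrite (big_pred1 tt) //; case.
apply: approx_sum F_complete closed_setT _ _ _ _ => // {n Fy}n x [q ->] Fx.
have [c cE] : dvd (S m b) (S n (y - q * b)).
  by apply: contrapT => nd; apply: noqk; exists q, n.
have [z Fz zE] := hcomp_ex S (n - m) c.
have Fzb : F n (z * b) by rewrite -(subrK m n); exact: filM.
exists (fun=> z); rewrite (big_pred1 tt); last by case.
split=> //; first by exists (q + z); rewrite mulrDl opprD addrA.
apply: (sy_eq (S := S) Fx Fzb); rewrite -(hcomp_syE S Fx) cE mulrC hcomp_mul_sy // zE.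
by rewrite syM // subrK.
Qed.

End Noetherian.

Section SymbolDomain.
Variables (A : nzRingType) (F : filtration A) (B : comNzRingType).
Variable S : symbol_map F B.
Hypothesis B_dom : is_comm_domain B.

Lemma filtered_domain (a b : A) : a <> 0 -> a * b = 0 -> b = 0.
Proof.
move=> /(sy_degree S) [n Fa a0] ab0; apply: contrapT => /(sy_degree S) [m Fb b0].
by apply: b0; apply: (dom_mulf_eq0 B_dom) a0; rewrite syM // ab0 sy0.
Qed.

Lemma fil_divr (a b : A) n m : F n b -> S n b <> 0 -> F m (a * b) -> F (m - n) a.
Proof.
move=> Fb b0 Fab; have [a0|/(sy_degree S) [k Fa a0]] := pselect (a = 0).
  by rewrite a0; exact: fil0.
apply: (fil_le _ Fa); rewrite leNgt; apply/negP => km.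
have : S (k + n) (a * b) = 0.
  by apply/sy_eq0; [exact: filM|apply: (fil_le _ Fab); lia].
by rewrite -syM // => /(dom_mulf_eq0 B_dom) /(_ a0).
Qed.

End SymbolDomain.

(** * Local description of reflexive ideals *)

Section Reflexive.
Variables (A : nzRingType) (F : filtration A) (B : comNzRingType).
Variable S : symbol_map F B.
Hypotheses (F_complete : fil_complete F) (B_dom : is_comm_domain B).
Hypotheses (B_noeth : is_noetherian B) (B_fac : prime_factorial B).
Hypothesis right_ore : forall a c : A, c <> 0 -> exists b u, b <> 0 /\ a * b = c * u.
Variables (I : set A) (M : lmodType A) (iota : M -> A).
Hypothesis I_ideal : two_sided_ideal I.
Hypothesis iota_linear : forall a x y, iota (a *: x + y) = a * iota x + iota y.
Hypothesis iota_inj : injective iota.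
Hypothesis iota_range : forall y, I y <-> exists m, iota m = y.

Lemma iota0 : iota 0 = 0.
Proof.
apply: (@addrI _ (iota 0)); rewrite addr0 -{1}[iota 0]mul1r -iota_linear scale1r.
by rewrite addr0.
Qed.

Lemma iotaZ a x : iota (a *: x) = a * iota x.
Proof. by rewrite -[a *: x]addr0 iota_linear iota0 addr0. Qed.

(* x lies in I locally at every height one prime q of gr A. *)
Definition locally_in (x : A) : Prop :=
  forall (q : B) (n : nat), prime_elt q -> exists s m, [/\ F m s, ~ dvd q (S m s) &
    exists2 i, I i & F (m - n%:Z) (s * x - i)].

(* Ore fractions identify a functional with right multiplication by u b^-1;
   x u is then divisible by b locally, hence globally. *)
Lemma locally_in_eval (phi : M -> A) (x : A) :
  (forall a m m', phi (a *: m + m') = a * phi m + phi m') ->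
  (exists2 c, I c & c <> 0) -> locally_in x ->
  exists a, forall r m, iota m = r * x -> phi m = r * a.
Proof.
move=> phi_lin [c Ic c0] xI.
have phi0 : phi 0 = 0.
  apply: (@addrI _ (phi 0)); rewrite addr0 -{1}[phi 0]mul1r -phi_lin scale1r.
  by rewrite addr0.
have phiZ a m : phi (a *: m) = a * phi m.
  by rewrite -[a *: m]addr0 phi_lin phi0 addr0.
have dom : forall a b : A, a <> 0 -> a * b = 0 -> b = 0 := filtered_domain S B_dom.
have [m0 m0c] := (iota_range c).1 Ic.
have [b [u [b0 bu]]] := right_ore (phi m0) c0.
have phiE m : phi m * b = iota m * u.
  have [r [r' [r0 rE]]] := left_ore S F_complete B_noeth (iota m) c0.
  apply/eqP; rewrite -subr_eq0; apply/eqP; apply: dom r0 _.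
  rewrite mulrBr !mulrA -phiZ (_ : r *: m = r' *: m0); last first.
    by apply: iota_inj; rewrite !iotaZ m0c.
  by rewrite phiZ -mulrA bu rE mulrA subrr.
have [a aE] : exists a, x * u = a * b.
  have [db Fb Sb0] := sy_degree S b0.
  have [//|[q [k [Fy ndvd]]]] := left_division S F_complete (x * u) Fb.
  have [N zP] := B_fac Sb0.
  have [P Pprime PP] := prime_prod_obstruction B_dom zP ndvd.
  have [du Fu] := fil_ex F u.
  (* The precision is chosen so that (s x - i) u falls below degree m + k. Then s y and w b have the
     same symbol there, so S b divides S s times S y, although [P] does not divide S s. *)
  have [s [m [Fs nPs [i Ii Fi]]]] := xI P (absz (du - k)%R).+1 Pprime.
  case: (PP _ nPs); have [mi miE] := (iota_range i).1 Ii.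
  set y := x * u - q * b; pose w := phi mi - s * q.
  have swE : s * y - w * b = (s * x - i) * u.
    by rewrite /y /w mulrBr !mulrBl phiE miE !mulrA opprB addrA subrK.
  have Fsy : F (m + k) (s * y) by exact: filM.
  have Fsw : F (m + k - 1) (s * y - w * b).
    by rewrite swE; apply: (fil_le _ (filM Fi Fu)); lia.
  have Fw : F (m + k) (w * b).
    rewrite -[w * b](subKr (s * y)); apply: filB => //.
    by apply: (fil_le _ Fsw); lia.
  exists (S (m + k - db) w); rewrite mulrC [LHS]syM // [RHS]mulrC syM //; last first.
    exact: (fil_divr B_dom Fb Sb0).
  rewrite subrK; apply/eqP; rewrite -subr_eq0 -syB //; apply/eqP.
  by apply/sy_eq0 => //; exact: filB.
exists a => r m mE; apply/subr0_eq; apply: contrapT => h; apply: b0.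
by apply: dom h _; rewrite mulrBl phiE mE -!mulrA aE subrr.
Qed.

(** Evaluation at [x] is an element of the bidual before [x] is known to lie in I: it sends f to the
    a with f(r x) = r a. By reflexivity it is evaluation at a point of [M], and testing on the
    inclusion identifies that point with [x]. Identities are checked after left multiplication by a
    nonzero [c] of I, because c x lies in I. *)
Lemma reflexive_mem (x : A) : reflexive_module A M -> (exists2 c, I c & c <> 0) ->
  locally_in x -> I x.
Proof.
move=> [g _ gK] [c Ic c0] xI.
have phi_lin (f : dual M) a m m' :
    (val f (a *: m + m') : A) = a * (val f m : A) + (val f m' : A).
  by have /asboolP := dual_valP f; exact.
have h (f : dual M) : exists a : A, forall r m, iota m = r * x -> (val f m : A) = r * a.
  by apply: locally_in_eval (phi_lin f) _ xI; exists c.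
have [Phi PhiP] := choice h.
have [mc mcE] : exists m, iota m = c * x.
  by apply: (iota_range _).1; case: I_ideal => _ _ _; apply.
have dom : forall a b : A, a <> 0 -> a * b = 0 -> b = 0 := filtered_domain S B_dom.
have Phi_dual : (Phi : dual M -> ((A^c : nzRingType)^c)^o) \in
    @dual_pred (A^c : nzRingType) (dual M : lmodType A^c).
  apply/asboolP => a f f'; apply/subr0_eq; apply: dom c0 _.
  rewrite mulrBr; apply/eqP; rewrite subr_eq0; apply/eqP.
  rewrite -(PhiP _ _ _ mcE) -[X in c * X]/(Phi f * a + Phi f').
  rewrite mulrDr mulrA -(PhiP _ _ _ mcE) -(PhiP _ _ _ mcE).
  by [].
pose Phi' : dual (dual M : lmodType (A^c : nzRingType)) := Dual Phi_dual.
have iota_dual : (iota : M -> (A^c)^o) \in @dual_pred A M.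
  by apply/asboolP => a m m'; exact: iota_linear.
have E : val (to_bidual (g Phi')) (Dual iota_dual) = val Phi' (Dual iota_dual).
  by rewrite gK.
apply: (iota_range _).2; exists (g Phi'); rewrite [LHS]E.
apply/subr0_eq; apply: dom c0 _; rewrite mulrBr.
by rewrite -(PhiP _ _ _ mcE) /= mcE subrr.
Qed.

End Reflexive.

(** * Elements of I close to A1 *)

Section OneSidedControl.
Variables (A : nzRingType) (F : filtration A) (B : comNzRingType).
Variable S : symbol_map F B.
Hypothesis B_dom : is_comm_domain B.

Lemma sy_exp n x k : F n x -> F (n *+ k) (x ^+ k) /\ S (n *+ k) (x ^+ k) = S n x ^+ k.
Proof.
move=> Fx; elim: k => [|k [IHF IHS]].
  by rewrite !expr0 mulr0n; split; [exact: fil1|exact: sy1].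
by rewrite !exprS mulrS -IHS syM //; split=> //; exact: filM.
Qed.

Lemma prime_dvd_exp (q b : B) k : prime_elt q -> dvd q (b ^+ k) -> dvd q b.
Proof.
move=> [q0 qU qD]; elim: k => [|k IHk].
  by move=> q1; case: qU; apply: dvd_unit q1 _; exists 1; rewrite mulr1.
by rewrite exprS => /qD [].
Qed.

Variables (A1 I : set A) (J : finType) (e : J -> A) (d : J -> int) (p : nat).
Variables (dX : int) (x1 : A).
Hypotheses (A1B : forall x y, A1 x -> A1 y -> A1 (x - y)).
Hypotheses (A1M : forall x y, A1 x -> A1 y -> A1 (x * y)).
Hypothesis basis_ex : forall n v, F n v -> exists c : J -> A,
  [/\ forall j, A1 (c j), forall j, F (n - d j) (c j) & v = \sum_j c j * e j].
Hypothesis basis_uniq : forall c : J -> A, (forall j, A1 (c j)) ->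
  \sum_j c j * e j = 0 -> forall j, c j = 0.
Hypothesis I_ideal : two_sided_ideal I.
Hypothesis p_gt0 : (0 < p)%N.
Hypothesis power_A1 : forall n x, F n x ->
  exists2 y, A1 y & F (n *+ p) y /\ S n x ^+ p = S (n *+ p) y.
Hypotheses (A1x1 : A1 x1) (Fx1 : F dX x1).
Let X := S dX x1.
Hypothesis X_neq0 : X <> 0.
Hypothesis X_dvd : forall n v, I v -> F n v -> dvd X (S n v).
Hypothesis X_coprime : forall q, prime_elt q -> exists n v,
  [/\ I v, F n v & exists2 s, S n v = X * s & ~ dvd q s].
Hypothesis X_lower : forall w1 eps m, A1 w1 -> F m eps -> I (w1 + eps) ->
  exists2 y, A1 y & F m y /\ dvd X (S m eps - S m y).

Lemma A1_0 : A1 0.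
Proof. by rewrite -(subrr x1); exact: A1B. Qed.

Lemma A1D x y : A1 x -> A1 y -> A1 (x + y).
Proof.
by move=> xA yA; rewrite -[y]opprK; apply: A1B => //; rewrite -sub0r; apply: A1B (A1_0) _.
Qed.

Lemma sy_dvdX n v : F n v -> dvd X (S n v) ->
  exists2 z, F (n - dX) z & S n v = X * S (n - dX) z.
Proof.
move=> Fv [c cE]; have [z Fz zE] := hcomp_ex S (n - dX) c; exists z => //.
by rewrite -(hcomp_syE S Fv) cE mulrC hcomp_mul_sy // zE mulrC.
Qed.

(** Each round gains one degree of precision and replaces s by its square, which stays prime to [q].
    With [n.+1] the error lies strictly below the degree of w1 from the start, so w1 alone carries
    the symbol X s. *)
Lemma ideal_near_subring (q : B) (n : nat) : prime_elt q ->
  exists w1 eps s ds, [/\ A1 w1 /\ A1 s, F (dX + ds) w1 /\ F ds s,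
    F (dX + ds - n.+1%:Z) eps, I (w1 + eps) &
    S (dX + ds) w1 = X * S ds s /\ ~ dvd q (S ds s)].
Proof.
move=> qP; have [I0 ID Il Ir] := I_ideal.
elim: n => [|n [w1 [eps [s [ds [[A1w A1s] [Fw Fs] Feps Iw [wE nqs]]]]]]].
  have [n [v [Iv Fv [b vE nqb]]]] := X_coprime qP.
  have [t Ft vEt] : exists2 t, F (n - dX) t & S n v = X * S (n - dX) t.
    by apply: sy_dvdX => //; rewrite vE; exists b.
  have bE : b = S (n - dX) t by apply: (dom_mulfI B_dom X_neq0); rewrite -vE.
  (* Multiplying v, of symbol X b, by t^(p-1) changes the cofactor b into b^p, which is the symbol
     of an element of A1. *)
  have [y A1y [Fy yE]] := power_A1 Ft.
  have [Ftp tpE] := sy_exp p.-1 Ft.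
  have degE : n + (n - dX) *+ p.-1 = dX + (n - dX) *+ p.
    by rewrite -[in RHS](prednK p_gt0) mulrS addrA subrKC.
  have Fvt : F (dX + (n - dX) *+ p) (v * t ^+ p.-1) by rewrite -degE; exact: filM.
  have Fxy : F (dX + (n - dX) *+ p) (x1 * y) by exact: filM.
  exists (x1 * y), (v * t ^+ p.-1 - x1 * y), y, ((n - dX) *+ p).
  split=> //; first by split=> //; exact: A1M.
  - apply: (sy_eq (S := S)) => //; rewrite -degE -syM // tpE vEt -mulrA -exprS.
    by rewrite prednK // yE syM // degE.
  - by rewrite addrC subrK; exact: Ir.
  - split; first by rewrite -syM.
    by rewrite -yE -bE => /(prime_dvd_exp qP).
have [y A1y [Fy]] := X_lower A1w Feps Iw.
rewrite -syB // => dX_eps.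
have [z Fz zE] := sy_dvdX (filB Feps Fy) dX_eps.
set m := dX + ds in Fw Feps wE Fy dX_eps Fz zE *.
have Fwe : F m (w1 + eps) by apply: filD => //; apply: (fil_le _ Feps); lia.
have SwE : S m (w1 + eps) = X * S ds s.
  rewrite syD // ?wE; last by apply: (fil_le _ Feps); lia.
  by rewrite (_ : S m eps = 0) ?addr0 //; apply/sy_eq0; apply: (fil_le _ Feps); lia.
(* The sum of the first two witnesses is (w1 + eps)(s - z). In the new error the leading terms
   cancel: eps - y has symbol X S(z), w1 + eps has symbol X S(s), so both products have symbol X
   S(s) S(z). *)
exists (w1 * s + y * s), ((eps - y) * s - (w1 + eps) * z), (s * s), (ds + ds).
have Fys : F (m + ds - 1) (y * s) by apply: (fil_le _ (filM Fy Fs)); lia.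
split.
- by split; [apply: A1D|]; apply: A1M.
- rewrite addrA; split; last exact: filM.
  by apply: filD; [exact: filM|apply: (fil_le _ Fys); lia].
- have Feys : F (m - n.+1%:Z + ds) ((eps - y) * s) by apply: filM => //; exact: filB.
  have Fwez : F (m - n.+1%:Z + ds) ((w1 + eps) * z).
    by apply: (fil_le _ (filM Fwe Fz)); lia.
  rewrite (_ : dX + _ - _ = m - n.+1%:Z + ds - 1); last by lia.
  apply: (sy_eq (S := S)) => //; rewrite -syM //; last exact: filB.
  rewrite (_ : m - n.+1%:Z + ds = m + (m - n.+1%:Z - dX)); last by lia.
  by rewrite -syM // zE SwE; ring.
- rewrite [Z in I Z](_ : _ = (w1 + eps) * (s - z)); first exact: Ir.
  rewrite mulrBr addrA; congr (_ - _).
  by rewrite !mulrDl mulNr addrACA subrr addr0.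
- rewrite addrA -/m; split; last first.
    by rewrite -syM //; have [_ _ qD] := qP => /qD [].
  rewrite syD; [|exact: filM|by apply: (fil_le _ Fys); lia].
  rewrite (_ : S (m + ds) (y * s) = 0) ?addr0; last first.
    by apply/sy_eq0 => //; apply: (fil_le _ Fys); lia.
  by rewrite -!syM // wE mulrA.
Qed.

(** Closeness to I is measured on the coordinates, not on [u]. The shift by [d j] makes every
    element of degree at most [D] qualify, with 0 as approximation in I. *)
Definition near_ideal (D : int) (u : A) : Prop := exists c : J -> A,
  [/\ forall j, A1 (c j), u = \sum_j c j * e j &
      forall j, exists2 i, I i & F (D - d j) (c j - i)].

Lemma near_idealD D u v : near_ideal D u -> near_ideal D v -> near_ideal D (u + v).
Proof.
have [I0 ID Il Ir] := I_ideal.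
move=> [c [A1c -> cI]] [c' [A1c' -> cI']]; exists (fun j => c j + c' j).
split=> [j||j]; first exact: A1D.
  by rewrite -big_split; apply: eq_bigr => j _; rewrite /= mulrDl.
have [i Ii Fi] := cI j; have [i' Ii' Fi'] := cI' j; exists (i + i'); first exact: ID.
by rewrite opprD addrACA; exact: filD.
Qed.

Lemma near_idealM D ds s u : A1 s -> F ds s -> near_ideal D u ->
  near_ideal (D + ds) (s * u).
Proof.
have [I0 ID Il Ir] := I_ideal.
move=> A1s Fs [c [A1c -> cI]]; exists (fun j => s * c j); split=> [j||j].
- exact: A1M.
- by rewrite mulr_sumr; apply: eq_bigr => j _; rewrite mulrA.
have [i Ii Fi] := cI j; exists (s * i); first exact: Il.
by rewrite -mulrBr (_ : D + ds - d j = ds + (D - d j)); [exact: filM|lia].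
Qed.

Lemma near_ideal_fil D u : F D u -> near_ideal D u.
Proof.
have [I0 ID Il Ir] := I_ideal.
move=> /basis_ex [c [A1c Fc ->]]; exists c; split=> // j.
by exists 0 => //; rewrite subr0.
Qed.

(** Left multiplication by w1 acts on the coordinates c_j of [z], and w1 c_j differs from the
    element (w1 + eps) c_j of I by eps c_j; the rest, eps z, is small as a whole. *)
Lemma near_ideal_mul n m w1 eps z D : A1 w1 -> I (w1 + eps) -> F m eps -> F n z ->
  m + n <= D -> near_ideal D ((w1 + eps) * z).
Proof.
have [I0 ID Il Ir] := I_ideal.
move=> A1w Iw Feps Fz mnD; rewrite mulrDl; apply: near_idealD; last first.
  by apply: near_ideal_fil; apply: (fil_le mnD); exact: filM.
have [c [A1c Fc ->]] := basis_ex Fz; exists (fun j => w1 * c j); split=> [j||j].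
- exact: A1M.
- by rewrite mulr_sumr; apply: eq_bigr => j _; rewrite mulrA.
exists ((w1 + eps) * c j); first exact: Ir.
rewrite mulrDl opprD addrA subrr sub0r; apply: filN.
by apply: (fil_le _ (filM Feps (Fc j))); lia.
Qed.

Lemma coord_locally_in (c : J -> A) : (forall j, A1 (c j)) ->
  I (\sum_j c j * e j) -> forall j, locally_in S I (c j).
Proof.
have [I0 ID Il Ir] := I_ideal.
move=> A1c; set v := \sum_j _ => Iv j q N qP.
(* [k] is both the number of division rounds and the precision asked of w1 + eps. After [k] rounds
   coordinate j is known modulo I up to degree n0 + k ds - k - d j, which is at most k ds - N. *)
have [n0 Fv] := fil_ex F v; pose k := (N + absz (n0 - d j)%R)%N.
have [w1 [eps [s [ds [[A1w A1s] [Fw Fs] Feps Iw [wE nqs]]]]]] := ideal_near_subring k qP.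
have Fwe : F (dX + ds) (w1 + eps) by apply: filD => //; apply: (fil_le _ Feps); lia.
have SwE : S (dX + ds) (w1 + eps) = X * S ds s.
  rewrite syD // ?wE; last by apply: (fil_le _ Feps); lia.
  rewrite (_ : S (dX + ds) eps = 0) ?addr0 //.
  by apply/sy_eq0; apply: (fil_le _ Feps); lia.
(* Division of v by w1 + eps with one factor s per round: u stays in I and loses one degree relative
   to s^i v, while g collects the quotient terms. *)
have step i : exists u g, [/\ I u, F (n0 + ds *+ i - i%:Z) u,
    near_ideal (n0 + ds *+ i - k%:Z) g & s ^+ i * v = u + g].
  elim: i => [|i [u [g [Iu Fu gN sE]]]].
    exists v, 0; split=> //; first by rewrite mulr0n addr0 subr0.
      by apply: near_ideal_fil; exact: fil0.
    by rewrite mul1r addr0.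
  have [z Fz zE] := sy_dvdX Fu (X_dvd Iu Fu).
  exists (s * u - (w1 + eps) * z), ((w1 + eps) * z + s * g); split.
  - by rewrite -mulrN; apply: ID; [exact: Il|exact: Ir].
  - pose D := ds + (n0 + ds *+ i - i%:Z).
    rewrite (_ : n0 + _ - _ = D - 1); last by rewrite /D mulrS; lia.
    have DE : D = dX + ds + (n0 + ds *+ i - i%:Z - dX) by rewrite /D; lia.
    apply: (sy_eq (S := S)); first exact: filM.
      by rewrite DE; exact: filM.
    by rewrite -syM // zE DE -syM // SwE; ring.
  - apply: near_idealD.
      by apply: (near_ideal_mul A1w Iw Feps Fz); rewrite mulrS; lia.
    rewrite (_ : n0 + _ - _ = n0 + ds *+ i - k%:Z + ds); last by rewrite mulrS; lia.
    exact: near_idealM.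
  - by rewrite exprS -mulrA sE mulrDr addrA subrK.
have [u [g [Iu Fu gN sE]]] := step k.
have [c' [A1c' cE' cI']] : near_ideal (n0 + ds *+ k - k%:Z) (s ^+ k * v).
  by rewrite sE; apply: near_idealD => //; exact: near_ideal_fil.
have A1sc i : A1 (s ^+ k * c i).
  elim: k {step u g Iu Fu gN sE c' A1c' cE' cI' Feps} => [|k IHk]; first by rewrite mul1r.
  by rewrite exprS -mulrA; exact: A1M.
have cc' i : s ^+ k * c i = c' i.
  apply/eqP; rewrite -subr_eq0; apply/eqP.
  apply: (basis_uniq (c := fun i => s ^+ k * c i - c' i)) => [i'|]; first exact: A1B.
  under eq_bigr => i' _ do rewrite mulrBl -mulrA.
  by rewrite sumrB -cE' -mulr_sumr subrr.
have [Fsk skE] := sy_exp k Fs.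
exists (s ^+ k), (ds *+ k); split=> //; first by rewrite skE => /(prime_dvd_exp qP).
have [i Ii Fi] := cI' j; exists i => //; rewrite cc'.
by apply: (fil_le _ Fi); rewrite /k; lia.
Qed.

End OneSidedControl.

(** * Derivations of B over B1 *)

Section EulerDerivations.
Variables (U B : comNzRingType) (iota : {rmorphism U -> B}) (p t : nat) (y : 'I_t -> B).
Hypothesis B_dom : is_comm_domain B.
Hypothesis iota_inj : injective iota.
Hypothesis p_prime : prime p.
Hypothesis p_char : p%:R = 0 :> B.
Hypothesis y_pow : forall i, range iota (y i ^+ p).
Hypothesis y_basis : forall b : B, exists! c : {ffun 'I_t -> 'I_p} -> B,
  (forall alpha, exists2 b1, range iota b1 & c alpha = b1 * \prod_i y i ^+ alpha i) /\
  b = \sum_alpha c alpha.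

Local Notation idx := {ffun 'I_t -> 'I_p}.
Local Notation B1 := (range iota).

Definition mon (g : 'I_t -> nat) : B := \prod_i y i ^+ g i.

Lemma monM g h : mon g * mon h = mon (fun i => g i + h i)%N.
Proof. by rewrite /mon -big_split; apply: eq_bigr => i _; rewrite /= exprD. Qed.

Lemma B1_0 : B1 0. Proof. by exists 0; rewrite // rmorph0. Qed.
Lemma B1_1 : B1 1. Proof. by exists 1; rewrite // rmorph1. Qed.
Lemma B1D b c : B1 b -> B1 c -> B1 (b + c).
Proof. by move=> [u _ <-] [v _ <-]; exists (u + v); rewrite // rmorphD. Qed.
Lemma B1M b c : B1 b -> B1 c -> B1 (b * c).
Proof. by move=> [u _ <-] [v _ <-]; exists (u * v); rewrite // rmorphM. Qed.
Lemma B1nat n : B1 n%:R.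
Proof. by exists n%:R; rewrite // rmorph_nat. Qed.

Lemma dom_mulf_neq0 (b c : B) : b <> 0 -> c <> 0 -> b * c <> 0.
Proof. by move=> b0 c0 /(dom_mulf_eq0 B_dom) /(_ b0). Qed.

Definition ev (a : idx) (i : 'I_t) : nat := a i.

(* The direct sum does not exclude y i = 0; coefficients of vanishing
   monomials are then normalised to 0. *)
Definition coords (b : B) (c : idx -> B) : Prop :=
  [/\ forall a, B1 (c a), forall a, mon (ev a) = 0 -> c a = 0 &
      b = \sum_a c a * mon (ev a)].

Lemma coords_uniq b c c' : coords b c -> coords b c' -> c = c'.
Proof.
move=> [cB c0 bE] [cB' c0' bE']; have [f [_ f_uniq]] := y_basis b.
have fE h : (forall a, B1 (h a)) -> b = \sum_a h a * mon (ev a) ->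
    f = fun a => h a * mon (ev a).
  by move=> hB hE; apply: f_uniq; split=> // a; exists (h a).
have E := etrans (esym (fE c cB bE)) (fE c' cB' bE').
apply/funext => a; have [m0|m0] := pselect (mon (ev a) = 0); first by rewrite c0 ?c0'.
apply: (dom_mulfI B_dom m0); rewrite mulrC [RHS]mulrC.
exact: (congr1 (fun h => h a) E).
Qed.

Lemma coords_ex b : exists c, coords b c.
Proof.
have [f [[fP bE] _]] := y_basis b.
have h a : exists b1, [/\ B1 b1, mon (ev a) = 0 -> b1 = 0 & f a = b1 * mon (ev a)].
  have [b1 b1B fE] := fP a; have [m0|m0] := pselect (mon (ev a) = 0).
    by exists 0; split=> //; [exact: B1_0|rewrite fE mul0r -/(mon (ev a)) m0 mulr0].
  by exists b1; split.
have [c cP] := choice h; exists c; split=> [a|a|]; [by have [] := cP a|by have [] := cP a|].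
by rewrite bE; apply: eq_bigr => a _; have [] := cP a.
Qed.

Definition coef (b : B) : idx -> B := projT1 (cid (coords_ex b)).

Lemma coefP b : coords b (coef b).
Proof. exact: projT2 (cid (coords_ex b)). Qed.

Lemma coef_B1 b a : B1 (coef b a). Proof. by have [] := coefP b. Qed.
Lemma coef_supp b a : mon (ev a) = 0 -> coef b a = 0. Proof. by have [_ + _] := coefP b; exact. Qed.
Lemma coefE b : b = \sum_a coef b a * mon (ev a). Proof. by have [] := coefP b. Qed.

Lemma coef_unique b c : coords b c -> coef b = c.
Proof. exact: coords_uniq (coefP b). Qed.

Lemma coefD b c a : coef (b + c) a = coef b a + coef c a.
Proof.
suff -> : coef (b + c) = fun a => coef b a + coef c a by [].
apply: coef_unique; split=> [a'|a' m0|].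
- by apply: B1D; exact: coef_B1.
- by rewrite !coef_supp ?addr0.
by rewrite {1}(coefE b) {1}(coefE c) -big_split; apply: eq_bigr => a' _; rewrite /= mulrDl.
Qed.

Lemma coefM b c a : B1 b -> coef (b * c) a = b * coef c a.
Proof.
move=> bB; suff -> : coef (b * c) = fun a => b * coef c a by [].
apply: coef_unique; split=> [a'|a' m0|].
- by apply: B1M => //; exact: coef_B1.
- by rewrite coef_supp // mulr0.
by rewrite {1}(coefE c) mulr_sumr; apply: eq_bigr => a' _; rewrite mulrA.
Qed.

Lemma coef0 a : coef 0 a = 0.
Proof. by rewrite -(mul0r 0) coefM ?mul0r //; exact: B1_0. Qed.

Lemma mon_eq0 g : mon g = 0 <-> exists2 j, y j = 0 & (0 < g j)%N.
Proof.
split=> [|[j yj gj]]; last first.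
  by rewrite /mon (bigD1 j) //= yj expr0n eqn0Ngt gj mul0r.
apply: contraPP => h; rewrite /mon; elim/big_ind: _.
- by move/eqP; rewrite oner_eq0.
- exact: dom_mulf_neq0.
move=> j _; have yg : (0 < g j)%N -> y j <> 0 by move=> gj yj; apply: h; exists j.
case: (g j) yg => [|k] /= yj; first by rewrite expr0 => /eqP; rewrite oner_eq0.
elim: k.+1 => [|n IHn]; first by rewrite expr0 => /eqP; rewrite oner_eq0.
by rewrite exprS; apply: dom_mulf_neq0 => //; exact: yj.
Qed.

Definition idx_mod (g : 'I_t -> nat) : idx :=
  [ffun j => Ordinal (ltn_pmod (g j) (prime_gt0 p_prime))].

Lemma natr_mod n : (n %% p)%:R = n%:R :> B.
Proof. by rewrite {2}(divn_eq n p) natrD natrM p_char mulr0 add0r. Qed.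

Lemma mon_mod g : exists2 b, B1 b & mon g = b * mon (ev (idx_mod g)).
Proof.
exists (\prod_i (y i ^+ p) ^+ (g i %/ p)).
  elim/big_ind: _ => [||j _]; [exact: B1_1|exact: B1M|].
  by elim: (_ %/ p)%N => [|n IHn]; [exact: B1_1|rewrite exprS; exact: B1M].
rewrite /mon -big_split; apply: eq_bigr => i _ /=.
by rewrite /ev ffunE /= -exprM -exprD mulnC -divn_eq.
Qed.

(** The operator y_i d/dy_i. It scales a monomial by its exponent, which matters only modulo p, so
    it is compatible with absorbing y_i^p into B1, and its Leibniz rule is additivity of
    exponents. *)
Definition euler (i : 'I_t) (b : B) : B := \sum_(a : idx) (a i)%:R * coef b a * mon (ev a).

Lemma eulerD i : {morph euler i : b c / b + c}.
Proof.
move=> b c; rewrite /euler -big_split; apply: eq_bigr => a _.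
by rewrite /= coefD mulrDr mulrDl.
Qed.

Lemma euler0 i : euler i 0 = 0.
Proof. by rewrite /euler big1 // => a _; rewrite coef0 mulr0 mul0r. Qed.

Lemma euler_mon i b g : B1 b -> euler i (b * mon g) = (g i)%:R * (b * mon g).
Proof.
move=> bB; have [c cB ->] := mon_mod g; set r := idx_mod g; rewrite mulrA.
have [m0|m0] := pselect (mon (ev r) = 0); first by rewrite m0 !mulr0 euler0.
have E : coef (b * c * mon (ev r)) = fun a => if a == r then b * c else 0.
  apply: coef_unique; split=> [a|a|].
  - by case: eqP => _; [exact: B1M|exact: B1_0].
  - by case: eqP => // ->.
  by rewrite (bigD1 r) //= eqxx big1 ?addr0 // => a /negPf ->; rewrite mul0r.
rewrite /euler E (bigD1 r) //= eqxx big1 ?addr0 => [|a /negPf ->]; last first.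
  by rewrite mulr0 mul0r.
by rewrite -mulrA; congr (_ * _); rewrite ffunE /= natr_mod.
Qed.

Lemma eulerM i b c : euler i (b * c) = euler i b * c + b * euler i c.
Proof.
rewrite [c]coefE; elim/big_ind: _ => [|c1 c2 IH1 IH2|a _].
- by rewrite mulr0 euler0 !mulr0 addr0.
- by rewrite mulrDr !eulerD IH1 IH2; ring.
rewrite [b]coefE; elim/big_ind: _ => [|b1 b2 IH1 IH2|a' _].
- by rewrite mul0r euler0 !mul0r addr0.
- by rewrite mulrDl !eulerD IH1 IH2; ring.
rewrite (euler_mon i (ev a') (coef_B1 b a')) (euler_mon i (ev a) (coef_B1 c a)).
rewrite mulrACA monM euler_mon; last by apply: B1M; exact: coef_B1.
by rewrite -monM natrD; ring.
Qed.

Definition shift (i : 'I_t) (a : idx) : idx := [ffun j => if j == i then ordS (a j) else a j].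

Lemma shift_surj i a : exists a', shift i a' = a.
Proof.
exists [ffun j => if j == i then ord_pred (a j) else a j].
by apply/ffunP => j; rewrite !ffunE; case: eqP => // _; rewrite ord_predK.
Qed.

Lemma shift_inj i : injective (shift i).
Proof.
move=> a b /ffunP ab; apply/ffunP => j; have := ab j; rewrite !ffunE.
by case: eqP => // _ /(can_inj (@ordSK p)).
Qed.

Lemma shift_supp i a : y i <> 0 -> mon (ev a) = 0 <-> mon (ev (shift i a)) = 0.
Proof.
move=> yi; split=> /mon_eq0 [j yj]; rewrite /ev ?ffunE => aj;
  apply/mon_eq0; exists j => //; move: aj; rewrite /ev ?ffunE; case: eqP => // ji;
  by rewrite ji in yj.
Qed.

(** The shift is cyclic so that it permutes the exponents; the wrap from p - 1 to 0 carries the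
    factor p = 0. *)
Lemma shift_val i a : ((shift i a i : nat) = (a i).+1 /\ y i * mon (ev a) = mon (ev (shift i a)))
  \/ ((a i).+1%:R = 0 :> B /\ (shift i a i : nat) = 0%N).
Proof.
have [ap|] := ltnP (a i).+1 p; last first.
  move=> pa; have aE : (a i).+1 = p by apply/eqP; rewrite eqn_leq pa ltn_ord.
  by right; rewrite ffunE eqxx /= aE modnn p_char.
left; have sE : (shift i a i : nat) = (a i).+1 by rewrite ffunE eqxx /= modn_small.
split=> //; rewrite /mon (bigD1 i) //= [in RHS](bigD1 i) //= {1 3}/ev sE mulrA -exprS.
by congr (_ * _); apply: eq_bigr => j /negPf ji; rewrite /ev ffunE ji.
Qed.

(** The derivation d/dy_i, read off coefficientwise. Its Leibniz rule is obtained from that of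
    [euler] by cancelling [y i], which is why it is used only for nonzero [y i]. *)
Definition pderiv (i : 'I_t) (b : B) : B :=
  \sum_(a : idx) (a i).+1%:R * coef b (shift i a) * mon (ev a).

Lemma pderiv_euler i b : y i * pderiv i b = euler i b.
Proof.
rewrite /euler (reindex_inj (@shift_inj i)) mulr_sumr; apply: eq_bigr => a _.
by have [[-> <-]|[-> ->]] := shift_val i a; [ring|rewrite !mul0r mulr0].
Qed.

Lemma pderivD i b c : pderiv i (b + c) = pderiv i b + pderiv i c.
Proof.
rewrite /pderiv -big_split; apply: eq_bigr => a _.
by rewrite /= coefD mulrDr mulrDl.
Qed.

Lemma pderivZ i b c : B1 b -> pderiv i (b * c) = b * pderiv i c.
Proof.
move=> bB; rewrite /pderiv mulr_sumr; apply: eq_bigr => a _.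
by rewrite coefM //; ring.
Qed.

Lemma pderivM i b c : y i <> 0 -> pderiv i (b * c) = pderiv i b * c + b * pderiv i c.
Proof.
move=> yi; apply: (dom_mulfI B_dom yi).
by rewrite pderiv_euler eulerM -!pderiv_euler; ring.
Qed.

Lemma coef_pderiv i b a : y i <> 0 -> coef (pderiv i b) a = (a i).+1%:R * coef b (shift i a).
Proof.
move=> yi; suff -> : coef (pderiv i b) = fun a => (a i).+1%:R * coef b (shift i a) by [].
apply: coef_unique; split=> // [a'|a' m0].
  by apply: B1M; [exact: B1nat|exact: coef_B1].
by rewrite coef_supp ?mulr0 //; apply/(shift_supp a' yi).
Qed.

Lemma coef_euler i b a : coef (euler i b) a = (a i)%:R * coef b a.
Proof.
suff -> : coef (euler i b) = fun a => (a i)%:R * coef b a by [].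
apply: coef_unique; split=> // [a'|a' m0].
  by apply: B1M; [exact: B1nat|exact: coef_B1].
by rewrite coef_supp ?mulr0.
Qed.

Lemma natr_inv k : (0 < k < p)%N -> exists m, m%:R * k%:R = 1 :> B.
Proof.
move=> /andP[k0 kp]; have : coprime k p.
  by rewrite coprime_sym prime_coprime // gtnNdvd.
case: (egcdnP p k0) => m n mE _ /eqP g1; exists m.
by rewrite -natrM mE g1 natrD natrM p_char mulr0 add0r.
Qed.

(** * Ideals stable under the partial derivatives *)

Section StableIdeal.
Variable L : set B.
Hypotheses (L0 : L 0) (LB : forall b c, L b -> L c -> L (b - c)).
Hypothesis LM : forall b c, L c -> L (b * c).

Lemma L_natr k b : (0 < k < p)%N -> L (k%:R * b) -> L b.
Proof. by move=> /natr_inv [m mk] /(LM m%:R); rewrite mulrA mk mul1r. Qed.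

Lemma L_sum (J : Type) (r : seq J) (P : pred J) (f : J -> B) :
  (forall j, P j -> L (f j)) -> L (\sum_(j <- r | P j) f j).
Proof.
move=> Lf; elim/big_ind: _ => // b c Lb Lc; rewrite -[c]opprK.
by apply: LB => //; rewrite -sub0r; exact: LB.
Qed.

(** Induction on a bound for the total degree. A partial derivative lowers the degree and exposes
    each nonconstant coefficient multiplied by an exponent between 1 and p - 1, which is invertible.
    The constant coefficient is [b] minus the remaining terms. *)
Lemma L_coef : (forall i b, y i <> 0 -> L b -> L (pderiv i b)) ->
  forall b a, L b -> L (coef b a).
Proof.
move=> L_pd; pose deg (a : idx) := (\sum_i a i)%N.
suff H n : forall b, L b -> (forall a, (n <= deg a)%N -> coef b a = 0) -> forall a, L (coef b a).
  move=> b a Lb; apply: (H (\max_a deg a).+1) => // a'.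
  by rewrite leqNgt ltnS leq_bigmax.
elim: n => [|n IHn] b Lb bdeg a; first by rewrite bdeg.
have Lpos (a' : idx) i : (0 < a' i)%N -> L (coef b a').
  have [yi|yi] := pselect (y i = 0).
    by move=> ai; rewrite coef_supp //; apply/mon_eq0; exists i.
  have [c <-] := shift_surj i a'.
  have : L (coef (pderiv i b) c).
    apply: IHn; first exact: L_pd.
    move=> d nd; rewrite coef_pderiv //; have [[sd _]|[-> _]] := shift_val i d; last first.
      by rewrite mul0r.
    rewrite bdeg ?mulr0 //; apply: (leq_trans (n := (deg d).+1)) => //.
    rewrite /deg (bigD1 i) //= [X in (_ <= X)%N](bigD1 i) //= sd addSn ltnS leq_add2l.
    by apply: leq_sum => j /negPf ji; rewrite ffunE ji.
  rewrite coef_pderiv //; have [[<- _]|[_ ->]] := shift_val i c; last by [].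
  by move=> Lc sc; apply: L_natr Lc; rewrite sc ltn_ord.
have [[i ai]|a0] := pselect (exists i, (0 < a i)%N); first exact: Lpos ai.
have m1 : mon (ev a) = 1.
  rewrite /mon big1 // => i _; rewrite /ev; case: (posnP (a i)) => [->|ai].
    by rewrite expr0.
  by case: a0; exists i.
have -> : coef b a = b - \sum_(c | c != a) coef b c * mon (ev c).
  by rewrite {2}[b]coefE (bigD1 a) //= m1 mulr1 addrK.
apply: LB => //; apply: L_sum => c ca; rewrite mulrC; apply: LM.
have [[i ci]|c0] := pselect (exists i, (0 < c i)%N); first exact: Lpos ci.
case/eqP: ca; apply/ffunP => i; apply/val_inj => /=.
case: (posnP (c i)) => [->|ci]; last by case: c0; exists i.
by case: (posnP (a i)) => [->|ai] //; case: a0; exists i.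
Qed.

End StableIdeal.

Lemma dvd_coef_self (X : B) : (forall i, y i <> 0 -> dvd X (pderiv i X)) ->
  forall a, dvd X (coef X a).
Proof.
move=> Xpd a; apply: (L_coef (L := dvd X)); [exact: dvd0|exact: dvdB|
  by move=> b c; exact: dvd_mull| |exact: dvd_refl].
move=> i b yi [c ->]; rewrite pderivM //; apply: dvdD.
  by apply: dvd_mulr; exact: Xpd.
by exists (pderiv i c).
Qed.

(** As [X] is a constant for the derivations, XB is stable, but [b] itself need not lie in it. The
    coefficient argument is applied to [euler i b], which does and whose coefficients are those of
    [b] times the exponents; only the constant coefficient escapes, and it is the element of B1
    sought. *)
Lemma dvd_coef (X b : B) : B1 X -> (forall i, y i <> 0 -> dvd X (pderiv i b)) ->
  exists2 b0, B1 b0 & dvd X (b - b0).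
Proof.
move=> XB bpd; have dvd_pos (a : idx) i : (0 < a i)%N -> dvd X (coef b a).
  have [yi|yi] := pselect (y i = 0).
    by move=> ai; rewrite coef_supp; [exact: dvd0|apply/mon_eq0; exists i].
  have : dvd X (coef (euler i b) a).
    apply: (L_coef (L := dvd X)); [exact: dvd0|exact: dvdB|
      by move=> c c'; exact: dvd_mull| |
      by rewrite -pderiv_euler; apply: dvd_mull; exact: bpd].
    by move=> j c yj [d ->]; rewrite pderivZ //; exists (pderiv j d).
  rewrite coef_euler => h ai; apply: (L_natr (L := dvd X)) h.
    by move=> c c'; exact: dvd_mull.
  by rewrite ai ltn_ord.
pose a0 : idx := idx_mod (fun=> 0%N).
exists (coef b a0); first exact: coef_B1.
have m1 : mon (ev a0) = 1.
  by rewrite /mon big1 // => i _; rewrite /ev ffunE /= mod0n expr0.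
rewrite {1}[b]coefE (bigD1 a0) //= m1 mulr1 addrAC subrr add0r.
apply: dvd_sum => a aa0; apply: dvd_mulr.
have [[i ai]|h] := pselect (exists i, (0 < a i)%N); first exact: dvd_pos ai.
case/eqP: aa0; apply/ffunP => i; apply/val_inj; rewrite ffunE /= mod0n.
by case: (posnP (a i)) => // ai; case: h; exists i.
Qed.

(* With X = iota g * X' for g = gcd G and u' in G / g, X' divides iota u'; since
   G / g is coprime, u' divides the cofactor (tested on coordinates), whence X'
   is a unit. *)
Lemma generator_descent (X : B) : is_comm_domain U -> prime_factorial U -> X <> 0 ->
  (forall a, dvd X (coef X a)) -> exists2 g, dvd X (iota g) & dvd (iota g) X.
Proof.
move=> U_dom U_fac X0 Xc; pose G : set U := [set u | dvd X (iota u)].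
have iota0 u : u <> 0 -> iota u <> 0.
  by move=> u0 iu; apply: u0; apply: iota_inj; rewrite iu rmorph0.
have [u0 Gu0 u0n] : exists2 u, G u & u <> 0.
  apply: contrapT => h; apply: X0; rewrite [X]coefE big1 // => a _.
  have [u _ uE] := coef_B1 X a; have [u0|u0] := pselect (u = 0).
    by rewrite -uE u0 rmorph0 mul0r.
  by case: h; exists u => //=; rewrite /G /= uE; exact: Xc.
have [|g g0 [Gg g_co]] := @gcd_exists U U_dom G U_fac; first by exists u0.
have [X' XE] : dvd (iota g) X.
  rewrite [X]coefE; apply: dvd_sum => a _; apply: dvd_mulr.
  have [u _ uE] := coef_B1 X a; have [|v vE] := Gg u; first by rewrite /G /= uE; exact: Xc.
  by exists (iota v); rewrite -uE vE rmorphM.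
have GgE v : G (g * v) -> exists w, iota v = X' * w.
  move=> [w wE]; exists w; apply: (dom_mulfI B_dom (iota0 _ g0)).
  by rewrite -rmorphM wE XE mulrA.
have [u' u'E] := Gg _ Gu0.
have [w wE] : exists w, iota u' = X' * w by apply: GgE; rewrite -u'E.
have u'0 : u' <> 0 by move=> h; apply: u0n; rewrite u'E h mulr0.
have dvd_w a : exists v, coef w a = iota (u' * v).
  have [z _ zE] := coef_B1 w a.
  have [v vE] : dvd u' z.
    apply: (coprime_set_dvd U_dom U_fac g_co u'0) => v /= /GgE [wv wvE].
    have [z' _ z'E] := coef_B1 wv a; exists z'; apply: iota_inj.
    rewrite !rmorphM zE z'E mulrC -!coefM; try by eexists.
    by congr coef; rewrite wvE wE; ring.
  by exists v; rewrite -zE vE.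
have [v vP] := choice dvd_w.
have [w' wE'] : dvd (iota u') w.
  rewrite [w]coefE; apply: dvd_sum => a _; apply: dvd_mulr; rewrite vP.
  by exists (iota (v a)); rewrite rmorphM.
exists g; last by exists X'.
exists w'; apply: (dom_mulfI B_dom (iota0 _ u'0)).
by rewrite XE {1}wE wE'; ring.
Qed.

End EulerDerivations.

(** * The associated graded ring *)

Section Opposite.
Variables (A : nzRingType) (F : filtration A).

Lemma op_filM n m (x y : A^c) : F n x -> F m y -> F (n + m) (x * y).
Proof. by move=> Fx Fy; rewrite addrC; exact: (filM Fy Fx). Qed.

Definition op_fil : filtration A^c :=
  @Filtration A^c F (fil0 F) (@filB _ F) (fil1 F) (@fil_incr _ F) op_filM
    (fil_exhaustive F) (fil_separated F).

Variables (B : comNzRingType) (S : symbol_map F B).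

Lemma op_syM n m (x y : A^c) : op_fil n x -> op_fil m y ->
  S n x * S m y = S (n + m) (x * y).
Proof. by move=> Fx Fy; rewrite mulrC addrC; exact: (syM S Fy Fx). Qed.

Definition op_symbol_map : symbol_map op_fil B :=
  @SymbolMap A^c op_fil B S (sy1 S) (@syB _ _ _ S) op_syM (@sy_eq0 _ _ _ S)
    (hcomp S) (@hcomp_sy _ _ _ S) (@hcomp_ex _ _ _ S) (@hcomp_sum _ _ _ S).

End Opposite.

(** The same carrier and operations with commutativity packed in, so that statements about [gr F]
    and about the commutative ring are convertible. *)
Definition com_ring (R : nzRingType) (mC : commutative (@GRing.mul R)) : comNzRingType :=
  HB.pack R (GRing.PzRing_hasCommutativeMul.Build R mC).

Section GrSymbol.
Variables (R : nzRingType) (F : filtration R).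

Lemma symbB n x y : F n x -> F n y -> symb F n (x - y) = symb F n x - symb F n y.
Proof.
move=> Fx Fy; rewrite /symb -raddfB; congr gr_pi; apply: val_inj.
rewrite (symbE (filB Fx Fy)) [RHS]raddfB /= (symbE Fx) (symbE Fy); apply/funext => k.
by rewrite /delta -[RHS]/((if _ then _ else _) - (if _ then _ else _)); case: eqP; rewrite ?subr0.
Qed.

Lemma symb0 n : symb F n 0 = 0.
Proof. by rewrite -(subrr 0) symbB ?subrr //; exact: fil0. Qed.

Lemma symb_eq0 n x : F n x -> symb F n x = 0 <-> F (n - 1) x.
Proof.
move=> Fx; have := symb_eq Fx (fil0 F n).
by rewrite symb0 subr0.
Qed.

Lemma symb1 : symb F 0 1 = 1.
Proof.
rewrite /symb -[RHS]/(gr_pi 1); congr gr_pi; apply: val_inj.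
by rewrite (symbE (fil1 F)).
Qed.

Definition gr_comp (n : int) (u : gr F) : gr F := symb F n (val (gr_lift u) n).

Lemma gr_comp_pi n f : gr_comp n (gr_pi f) = symb F n (val f n).
Proof.
apply/symb_eq; [exact: rees_fil|exact: rees_fil|].
have /asboolP/(_ n) : gr_lift (gr_pi f) - f \in @gr_rel R F by apply/gr_piP; rewrite gr_liftK.
by [].
Qed.

Lemma gr_comp_zmod_morphism n : zmod_morphism (gr_comp n).
Proof.
move=> u v; rewrite -(gr_liftK u) -(gr_liftK v) -raddfB !gr_comp_pi.
by rewrite -symbB //; exact: rees_fil.
Qed.

HB.instance Definition _ n :=
  GRing.isZmodMorphism.Build (gr F) (gr F) (gr_comp n) (gr_comp_zmod_morphism n).

Lemma gr_comp_symb n m x : F n x ->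
  gr_comp m (symb F n x) = if m == n then symb F n x else 0.
Proof.
move=> Fx; rewrite {1}/symb gr_comp_pi (symbE Fx) /delta.
by case: eqP => [->//|_]; rewrite symb0.
Qed.

Lemma gr_comp_ex n u : exists2 x, F n x & gr_comp n u = symb F n x.
Proof. by exists (val (gr_lift u) n) => //; exact: rees_fil. Qed.

Lemma gr_comp_sum u : exists2 s : seq int, uniq s & u = \sum_(n <- s) gr_comp n u.
Proof.
exists (rees_supp (gr_lift u)); first exact: fset_uniq.
rewrite -{1}(gr_liftK u) /gr_comp /symb -raddf_sum; congr gr_pi; apply: val_inj.
set f := gr_lift u; apply/funext => m.
rewrite (big_morph (fun g : rees F => val g m) (id1 := 0) (op1 := +%R)) //.
have delta_m n : val (insubd (0 : rees F) (delta n (val f n))) m = if m == n then val f n else 0.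
  by rewrite symbE //; exact: rees_fil.
rewrite (eq_bigr _ (fun n _ => delta_m n)).
have [ms|ms] := boolP (m \in rees_supp f).
  rewrite (bigD1_seq m) ?fset_uniq //= eqxx big1 ?addr0 // => n.
  by rewrite eq_sym => /negPf ->.
rewrite (rees_suppP ms) big1_seq // => n /= ns; case: eqP => // mn.
by case/negP: ms; rewrite mn.
Qed.

Variable mC : commutative (@GRing.mul (gr F)).

Definition gr_symbol_map : symbol_map F (com_ring mC) :=
  @SymbolMap R F (com_ring mC) (@symb R F) symb1 symbB (@symbM R F) symb_eq0
    gr_comp gr_comp_symb gr_comp_ex gr_comp_sum.

End GrSymbol.

Section GrIncl.
Variables (R : nzRingType) (F : filtration R) (S : subringClosed R).
Let F1 := sub_filtration F S.

Lemma gr_incl_symb n (x : subring S) : F1 n x -> gr_incl (symb F1 n x) = symb F n (val x).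
Proof. by move=> Fx; rewrite /gr_incl gr_map_symb // subr0. Qed.

Lemma gr_incl_pi (f : rees F1) :
  gr_incl (gr_pi f) = gr_pi (rees_map (phi := val : {additive subring S -> R}) (@val_deg0 R F S) f).
Proof. exact: gr_map_pi. Qed.

Lemma gr_incl_comp n (u : gr F1) : exists2 x, x \in S & F n x /\ gr_comp n (gr_incl u) = symb F n x.
Proof.
exists (val (val (gr_lift u) n)); first exact: subring_valP.
split; first exact: (rees_fil (gr_lift u) n).
by rewrite -{1}(gr_liftK u) gr_incl_pi gr_comp_pi /= addr0.
Qed.

Lemma gr_incl_zmod_morphism : zmod_morphism (@gr_incl R F S).
Proof.
move=> u v; rewrite -(gr_liftK u) -(gr_liftK v) -raddfB !gr_incl_pi -raddfB.
congr gr_pi; apply: val_inj; apply/funext => n.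
by [].
Qed.

HB.instance Definition _ :=
  GRing.isZmodMorphism.Build (gr F1) (gr F) (@gr_incl R F S) gr_incl_zmod_morphism.

Lemma gr_incl_monoid_morphism : monoid_morphism (@gr_incl R F S).
Proof.
split=> [|u v].
  by rewrite -[1 in LHS](symb1 F1) gr_incl_symb ?symb1 //; exact: (fil1 F).
rewrite -(gr_liftK u) -(gr_liftK v).
rewrite -[_ * _ in LHS]gr_piM !gr_incl_pi -[RHS]gr_piM.
congr gr_pi; apply: val_inj; apply/funext => n.
rewrite /= addr0; set f := gr_lift u; set g := gr_lift v.
rewrite (convE _ _ (@rees_suppP _ _ f)) (convE (A := rees_supp f)) => [|i iA]; last first.
  by rewrite /= addr0; exact: (congr1 val (rees_suppP iA)).
rewrite [LHS](raddf_sum (val : {additive subring S -> R})); apply: eq_bigr => i _.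
by rewrite /= !addr0.
Qed.

HB.instance Definition _ :=
  GRing.isMonoidMorphism.Build (gr F1) (gr F) (@gr_incl R F S) gr_incl_monoid_morphism.

Lemma gr_incl_inj : injective (@gr_incl R F S).
Proof.
move=> u v; rewrite -(gr_liftK u) -(gr_liftK v) !gr_incl_pi => /gr_piP /asboolP uv.
apply/gr_piP/asboolP => n; have := uv n.
by rewrite -[val _ n]/(val (val (gr_lift u) (n + 0)) - val (val (gr_lift v) (n + 0))) addr0.
Qed.

End GrIncl.

(** * Descent of reflexivity along a free extension *)

Section ReflexiveDescent.
Variables (R S : nzRingType) (j : S -> R) (J : finType) (e : J -> R) (k0 : J).
Hypotheses (jD : {morph j : x y / x + y}) (jM : {morph j : x y / x * y}).
Hypothesis j_inj : injective j.
Hypothesis e_k0 : e k0 = 1.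
Variables lam rho : R -> J -> S.
Hypothesis lamE : forall r, r = \sum_k j (lam r k) * e k.
Hypothesis lam_unique : forall r c, r = \sum_k j (c k) * e k -> lam r = c.
Hypothesis rhoE : forall r, r = \sum_k e k * j (rho r k).
Hypothesis rho_unique : forall r c, r = \sum_k e k * j (c k) -> rho r = c.
Variables (I : set R) (M : lmodType R) (iota : M -> R) (N : lmodType S) (nu : N -> S).
Hypothesis iota_linear : forall a x y, iota (a *: x + y) = a * iota x + iota y.
Hypothesis iota_inj : injective iota.
Hypothesis iota_range : forall y, I y <-> exists m, iota m = y.
Hypothesis nu_linear : forall a x y, nu (a *: x + y) = a * nu x + nu y.
Hypothesis nu_inj : injective nu.
Hypothesis nu_range : forall y, I (j y) <-> exists n, nu n = y.
Hypothesis control : forall r k, I r -> I (j (rho r k)).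

Lemma j0 : j 0 = 0.
Proof. by apply: (@addrI _ (j 0)); rewrite -jD !addr0. Qed.

Lemma j_sum (T : Type) (r : seq T) (f : T -> S) : j (\sum_(i <- r) f i) = \sum_(i <- r) j (f i).
Proof. exact: (big_morph j jD j0). Qed.

Lemma lam_linear a r r' k : lam (j a * r + r') k = a * lam r k + lam r' k.
Proof.
suff -> : lam (j a * r + r') = fun k => a * lam r k + lam r' k by [].
apply: lam_unique; rewrite {1}(lamE r) {1}(lamE r') mulr_sumr -big_split /=.
by apply: eq_bigr => i _; rewrite jD jM mulrDl mulrA.
Qed.

Lemma lam_right a r r' l :
  lam (r * a + r') l = \sum_k lam r k * lam (e k * a) l + lam r' l.
Proof.
suff -> : lam (r * a + r') = fun l => \sum_k lam r k * lam (e k * a) l + lam r' l by [].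
apply: lam_unique; rewrite {1}(lamE r) {1}(lamE r') mulr_suml.
under eq_bigr => k _ do rewrite -mulrA {1}(lamE (e k * a)) mulr_sumr.
rewrite exchange_big -big_split /=; apply: eq_bigr => i _.
rewrite jD mulrDl; congr (_ + _); rewrite j_sum mulr_suml.
by apply: eq_bigr => k _; rewrite jM mulrA.
Qed.

(** Left multiplication by [a] acts on right coordinates through the matrix [rho (a * e l) k]; this
    gives the R-linearity of functionals extended through right coordinates. *)
Lemma rho_left a r r' k :
  rho (a * r + r') k = \sum_l rho (a * e l) k * rho r l + rho r' k.
Proof.
suff -> : rho (a * r + r') = fun k => \sum_l rho (a * e l) k * rho r l + rho r' k by [].
apply: rho_unique; rewrite {1}(rhoE r) {1}(rhoE r') mulr_sumr.
under eq_bigr => l _ do rewrite mulrA {1}(rhoE (a * e l)) mulr_suml.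
rewrite exchange_big -big_split /=; apply: eq_bigr => i _.
rewrite jD mulrDr; congr (_ + _); rewrite j_sum mulr_sumr.
by apply: eq_bigr => l _; rewrite jM mulrA.
Qed.

Lemma lam_j s k : lam (j s) k = if k == k0 then s else 0.
Proof.
suff -> : lam (j s) = fun k => if k == k0 then s else 0 by [].
apply: lam_unique; rewrite (bigD1 k0) //= eqxx e_k0 mulr1 big1 ?addr0 //.
by move=> i /negPf ->; rewrite j0 mul0r.
Qed.

Lemma rho_j s k : rho (j s) k = if k == k0 then s else 0.
Proof.
suff -> : rho (j s) = fun k => if k == k0 then s else 0 by [].
apply: rho_unique; rewrite (bigD1 k0) //= eqxx e_k0 mul1r big1 ?addr0 //.
by move=> i /negPf ->; rewrite j0 mulr0.
Qed.

Lemma dual_linear (T : nzRingType) (V : lmodType T) (f : dual V) a x y :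
  (val f (a *: x + y) : T) = a * (val f x : T) + (val f y : T).
Proof. by have /asboolP := dual_valP f; exact. Qed.

Lemma incl_lift_ex : exists incl_lift : N -> M, forall n, iota (incl_lift n) = j (nu n).
Proof.
have h n : exists m, iota m = j (nu n).
  by apply/(iota_range _); apply/nu_range; exists n.
by have [incl_lift incl_liftP] := choice h; exists incl_lift.
Qed.

Definition incl_lift : N -> M := projT1 (cid incl_lift_ex).

Lemma incl_liftP n : iota (incl_lift n) = j (nu n).
Proof. exact: (projT2 (cid incl_lift_ex)). Qed.

Lemma incl_lift_linear a n n' : incl_lift (a *: n + n') = j a *: incl_lift n + incl_lift n'.
Proof. by apply: iota_inj; rewrite iota_linear !incl_liftP nu_linear jD jM. Qed.

Lemma restr_subproof (phi : dual M) (k : J) :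
  (fun n => lam (val phi (incl_lift n) : R) k : (S^c)^o) \in @dual_pred S N.
Proof.
apply/asboolP => a n n'; rewrite incl_lift_linear dual_linear.
exact: lam_linear.
Qed.

Definition restr (phi : dual M) (k : J) : dual N := Dual (restr_subproof phi k).

Lemma restrD (phi phi' : dual M) (a : R) l :
  restr ((a : R^c) *: phi + phi') l =
  \sum_k (lam (e k * a) l : S^c) *: restr phi k + restr phi' l.
Proof.
have valS (g : J -> dual N) n :
    (val (\sum_k g k) n : S) = \sum_k (val (g k) n : S).
  exact: (big_morph (fun f : dual N => (val f n : S)) (id1 := 0) (op1 := +%R)).
apply: val_inj; apply/funext => n.
rewrite -[RHS]/((val (\sum_k (lam (e k * a) l : S^c) *: restr phi k) n : S) +
   val (restr phi' l) n) valS.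
exact: (lam_right a (val phi (incl_lift n)) (val phi' (incl_lift n)) l).
Qed.

(** The extension sends m to the sum of e_k psi(rho_k m). Control enters here: the right coordinates
    of an element of I must lie in I for [psi] to apply to them. *)
Lemma extension_ex (psi : dual N) : exists phi : dual M,
  forall n, (val phi (incl_lift n) : R) = j (val psi n).
Proof.
have h (m : M) : exists c : J -> N, forall k, nu (c k) = rho (iota m) k.
  have h' k : exists n, nu n = rho (iota m) k.
    by apply/nu_range; apply: control; apply/iota_range; exists m.
  by have [c cP] := choice h'; exists c.
have [c cP] := choice h.
have psi0 : (val psi 0 : S) = 0.
  apply: (@addrI _ (val psi 0 : S)); rewrite addr0.
  by have := dual_linear psi 1 0 0; rewrite scale1r mul1r addr0 => <-.
pose phi (m : M) : R := \sum_k e k * j (val psi (c m k)).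
have psi_sum (f : J -> S) (g : J -> N) :
    (val psi (\sum_l f l *: g l) : S) = \sum_l f l * (val psi (g l) : S).
  rewrite (big_morph (fun n => (val psi n : S)) (id1 := 0) (op1 := +%R)) //.
    apply: eq_bigr => l _.
    by have := dual_linear psi (f l) (g l) 0; rewrite addr0 psi0 addr0.
  by move=> x y; have := dual_linear psi 1 x y; rewrite scale1r mul1r.
have nu0 : nu 0 = 0.
  apply: (@addrI _ (nu 0)); rewrite addr0.
  by have := nu_linear 1 0 0; rewrite scale1r mul1r addr0 => <-.
have nu_sum (f : J -> S) (g : J -> N) : nu (\sum_l f l *: g l) = \sum_l f l * nu (g l).
  rewrite (big_morph nu (id1 := 0) (op1 := +%R)) //.
    by apply: eq_bigr => l _; have := nu_linear (f l) (g l) 0; rewrite addr0 nu0 addr0.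
  by move=> x y; have := nu_linear 1 x y; rewrite scale1r mul1r.
have phi_dual : (phi : M -> (R^c)^o) \in @dual_pred R M.
  apply/asboolP => a m m'.
  have cE k : c (a *: m + m') k = \sum_l rho (a * e l) k *: c m l + c m' k.
    apply: nu_inj; rewrite cP iota_linear rho_left.
    have := nu_linear 1 (\sum_l rho (a * e l) k *: c m l) (c m' k).
    rewrite scale1r mul1r => ->; rewrite nu_sum cP; congr (_ + _).
    by apply: eq_bigr => l _; rewrite cP.
  rewrite -[RHS]/(a * phi m + phi m') /phi.
  under eq_bigr => k _.
    have := dual_linear psi 1 (\sum_l rho (a * e l) k *: c m l) (c m' k).
    rewrite scale1r mul1r -cE => ->; rewrite psi_sum jD mulrDr j_sum mulr_sumr.
    over.
  rewrite /= big_split /=; congr (_ + _); rewrite exchange_big mulr_sumr /=.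
  apply: eq_bigr => l _; rewrite mulrA {2}(rhoE (a * e l)) mulr_suml.
  by apply: eq_bigr => k _; rewrite jM mulrA.
exists (Dual phi_dual) => n /=; rewrite /phi (bigD1 k0) //= e_k0 mul1r big1 ?addr0.
  by congr (j (val psi _)); apply: nu_inj; rewrite cP incl_liftP rho_j eqxx.
move=> k kk0; rewrite (_ : c (incl_lift n) k = 0) ?psi0 ?j0 ?mulr0 //.
by apply: nu_inj; rewrite cP incl_liftP rho_j (negPf kk0) nu0.
Qed.

(** A functional Phi on the dual of [N] is carried to the dual of [M] by applying it to the left
    coordinates of restricted functionals. Reflexivity represents the result by a point of [M];
    evaluated at the inclusion it lies in the image of [S], so it comes from [N]. Extending
    functionals from [N] to [M] then shows that this point represents Phi. *)
Lemma reflexive_descent : reflexive_module R M -> reflexive_module S N.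
Proof.
move=> [g _ gK].
have nu_dual : (nu : N -> (S^c)^o) \in @dual_pred S N.
  by apply/asboolP => a n n'; exact: nu_linear.
(* Surjectivity suffices, since the inclusion [nu] is itself a functional and separates points. *)
suff surj (Phi : dual (dual N : lmodType (S^c : nzRingType))) :
    exists n, to_bidual n = Phi.
  have [h hK] := choice surj; exists h => // n; apply: nu_inj.
  exact: (congr1 (fun z : dual (dual N : lmodType (S^c : nzRingType)) =>
    (val z (Dual nu_dual) : S)) (hK (to_bidual n))).
have PhiL (a : S) (f f' : dual N) :
    (val Phi ((a : S^c) *: f + f') : S) = (val Phi f : S) * a + (val Phi f' : S).
  exact: (dual_linear Phi).
have Phi0 : (val Phi 0 : S) = 0.
  apply: (@addrI _ (val Phi 0 : S)); rewrite addr0.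
  by have := PhiL 1 0 0; rewrite scale1r mulr1 addr0 => <-.
have Phi_sum (a : J -> S) (f : J -> dual N) :
    (val Phi (\sum_k (a k : S^c) *: f k) : S) = \sum_k (val Phi (f k) : S) * a k.
  rewrite (big_morph (fun n => (val Phi n : S)) (id1 := 0) (op1 := +%R)) //.
    by apply: eq_bigr => k _; have := PhiL (a k) (f k) 0; rewrite addr0 Phi0 addr0.
  by move=> x y; have := PhiL 1 x y; rewrite scale1r mulr1.
pose PhiM (phi : dual M) : R := \sum_k j (val Phi (restr phi k)) * e k.
have PhiM_dual : (PhiM : dual M -> ((R^c : nzRingType)^c)^o) \in
    @dual_pred (R^c : nzRingType) (dual M : lmodType R^c).
  apply/asboolP => a phi phi'; rewrite -[RHS]/(PhiM phi * a + PhiM phi') /PhiM.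
  under eq_bigr => l _.
    rewrite restrD -[X in X + _]scale1r PhiL mulr1 Phi_sum jD j_sum mulrDl mulr_suml.
    over.
  rewrite /= big_split /=; congr (_ + _); rewrite exchange_big mulr_suml /=.
  apply: eq_bigr => k _; rewrite -mulrA {2}(lamE (e k * a)) mulr_sumr.
  by apply: eq_bigr => l _; rewrite jM mulrA.
pose PhiM' : dual (dual M : lmodType (R^c : nzRingType)) := Dual PhiM_dual.
have mE (phi : dual M) : (val phi (g PhiM') : R) = PhiM phi.
  exact: (congr1 (fun z : dual (dual M : lmodType (R^c : nzRingType)) =>
    (val z phi : R)) (gK PhiM')).
have PhiM_j (phi : dual M) (psi : dual N) :
    (forall n, (val phi (incl_lift n) : R) = j (val psi n)) -> PhiM phi = j (val Phi psi).
  move=> phiE; rewrite /PhiM (bigD1 k0) //= e_k0 mulr1 big1 ?addr0 => [|k kk0].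
    congr (j (val Phi _)); apply: val_inj; apply/funext => n /=.
    by rewrite phiE lam_j eqxx.
  rewrite (_ : restr phi k = 0) ?Phi0 ?j0 ?mul0r //; apply: val_inj; apply/funext => n /=.
  by rewrite phiE lam_j (negPf kk0).
have iota_dual : (iota : M -> (R^c)^o) \in @dual_pred R M.
  by apply/asboolP => a m m'; exact: iota_linear.
have iotaE : iota (g PhiM') = j (val Phi (Dual nu_dual)).
  rewrite -(PhiM_j (Dual iota_dual)); first exact: (mE (Dual iota_dual)).
  by move=> n; exact: incl_liftP.
have [n nE] : exists n, nu n = val Phi (Dual nu_dual).
  by apply/nu_range; apply/iota_range; exists (g PhiM').
have mE' : g PhiM' = incl_lift n by apply: iota_inj; rewrite incl_liftP nE.
exists n; apply: val_inj; apply/funext => psi /=; apply: j_inj.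
have [phi phiE] := extension_ex psi.
by rewrite -phiE -mE' mE; exact: PhiM_j.
Qed.

End ReflexiveDescent.

(** * Frobenius pairs *)

Section LiftedBasis.
Variables (A : nzRingType) (F : filtration A) (B : comNzRingType).
Variable S : symbol_map F B.
Hypothesis F_complete : fil_complete F.
Variables (A1 : set A) (J : finType) (e : J -> A) (d : J -> int).
Hypothesis A1_closed : fil_closed F A1.
Hypotheses (A1_0 : A1 0) (A1_D : forall x y, A1 x -> A1 y -> A1 (x + y)).
Hypothesis Fe : forall j, F (d j) (e j).
Hypothesis sy_span : forall n v, F n v -> exists c : J -> A,
  [/\ forall j, A1 (c j), forall j, F (n - d j) (c j) &
      S n v = \sum_j S (n - d j) (c j) * S (d j) (e j)].
Hypothesis sy_indep : forall n (c : J -> A), (forall j, A1 (c j)) ->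
  (forall j, F (n - d j) (c j)) -> \sum_j S (n - d j) (c j) * S (d j) (e j) = 0 ->
  forall j, S (n - d j) (c j) = 0.

Lemma sy_sum_basis n (c : J -> A) : (forall j, F (n - d j) (c j)) ->
  F n (\sum_j c j * e j) /\
  S n (\sum_j c j * e j) = \sum_j S (n - d j) (c j) * S (d j) (e j).
Proof.
move=> Fc; have Fce j : F n (c j * e j) by rewrite -(subrK (d j) n); exact: filM.
split; first exact: fil_sum.
by rewrite sy_sum //; apply: eq_bigr => j _; rewrite syM // subrK.
Qed.

Lemma lifted_basis_span n v : F n v -> exists c : J -> A,
  [/\ forall j, A1 (c j), forall j, F (n - d j) (c j) & v = \sum_j c j * e j].
Proof.
move=> Fv; apply: (approx_sum (Q := setT) F_complete A1_closed A1_0 A1_D Fe) => //.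
move=> {v Fv}n v _ Fv; have [c [A1c Fc cE]] := sy_span Fv; have [Fs Ss] := sy_sum_basis Fc.
by exists c; split=> //; apply: (sy_eq (S := S)) => //; rewrite cE Ss.
Qed.

(** Independence of the symbols pushes all coefficients of a vanishing sum down by one degree, again
    and again, and the filtration is separated. *)
Lemma lifted_basis_indep (c : J -> A) : (forall j, A1 (c j)) ->
  \sum_j c j * e j = 0 -> forall j, c j = 0.
Proof.
move=> A1c c0; have down n : (forall j, F (n - d j) (c j)) -> forall j, F (n - 1 - d j) (c j).
  move=> Fc j; have [_ Ss] := sy_sum_basis Fc; rewrite addrAC; apply/(sy_eq0 S (Fc j)).
  by apply: sy_indep => //; rewrite -Ss c0 sy0.
have [m Fm] : exists m : J -> int, forall j, F (m j) (c j).
  by have [m mP] := choice (fun j => fil_ex F (c j)); exists m.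
pose n : int := (\sum_j absz (m j + d j)%R)%N.
have Fn j : F (n - d j) (c j).
  apply: (fil_le _ (Fm j)); have : (absz (m j + d j)%R <= \sum_j absz (m j + d j)%R)%N.
    by rewrite (bigD1 j) //= leq_addr.
  by rewrite /n; lia.
have Fk (k : nat) : forall j, F (n - k%:Z - d j) (c j).
  elim: k => [|k IHk] j; first by rewrite subr0.
  by rewrite (_ : n - k.+1%:Z = n - k%:Z - 1); [exact: down|lia].
by move=> j; apply: (@fil_eq0 _ F (n - d j)) => k; rewrite addrAC.
Qed.

End LiftedBasis.

Lemma sy_prod (A : nzRingType) (F : filtration A) (B : comNzRingType) (S : symbol_map F B)
    (T : Type) (r : seq T) (n : T -> int) (x : T -> A) :
  (forall i, F (n i) (x i)) -> F (\sum_(i <- r) n i) (\prod_(i <- r) x i) /\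
  S (\sum_(i <- r) n i) (\prod_(i <- r) x i) = \prod_(i <- r) S (n i) (x i).
Proof.
move=> Fx; elim: r => [|i r [IHF IHS]].
  by rewrite !big_nil; split; [exact: fil1|exact: sy1].
by rewrite !big_cons -IHS syM //; split=> //; exact: filM.
Qed.

Section IdealModuleVal.
Variables (R : nzRingType) (I : set R) (hI : two_sided_ideal I).

Lemma left_val_linear a (x y : left_ideal_mod hI) :
  (val (a *: x + y) : R) = a * (val x : R) + (val y : R).
Proof. by []. Qed.

Lemma right_val_linear (a : R^c) (x y : right_ideal_mod hI) :
  (val (a *: x + y) : R^c) = (a : R^c) * (val x : R^c) + (val y : R^c).
Proof. by []. Qed.

Lemma left_val_range y : I y <-> exists m : left_ideal_mod hI, val m = y.
Proof.
split=> [Iy|[[z /= /asboolP Iz] <-]//].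
have yP : (y : R^o) \in left_pred I by apply/asboolP.
by exists (Sub (y : R^o) yP).
Qed.

Lemma right_val_range y : I y <-> exists m : right_ideal_mod hI, val m = y.
Proof.
split=> [Iy|[[z /= /asboolP Iz] <-]//].
have yP : (y : (R^c)^o) \in right_pred I by apply/asboolP.
by exists (Sub (y : (R^c)^o) yP).
Qed.

Lemma op_two_sided : @two_sided_ideal R^c I.
Proof. by case: hI => I0 ID Il Ir; split. Qed.

End IdealModuleVal.

Section FrobeniusPair.
Variables (p : nat) (K : fieldType) (A : algType K).
Variables (F : filtration A) (A1 : subringClosed A) (I : set A).
Hypothesis p_char : p \in [pchar K].
Hypothesis mC : commutative (@GRing.mul (gr F)).
Hypothesis mC1 : commutative (@GRing.mul (gr (sub_filtration F A1))).
Local Notation B := (com_ring mC).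
Local Notation U := (com_ring mC1).
Let S : symbol_map F B := gr_symbol_map mC.
Let iota : {rmorphism U -> B} := (@gr_incl A F A1 : {rmorphism gr (sub_filtration F A1) -> gr F}).
Let A1s : set A := [set x | x \in A1].
Hypothesis F_complete : fil_complete F.
Hypothesis A1_closed : fil_closed F A1s.
Hypotheses (B_ufd : is_ufd B) (U_ufd : is_ufd U) (B_noeth : is_noetherian B).
Hypothesis B_pow : forall b : B, range iota (b ^+ p).
Variables (t : nat) (y : 'I_t -> B).
Hypothesis y_homog : forall i, homogeneous (y i : gr F).
Hypothesis y_basis : forall b : B, exists! c : {ffun 'I_t -> 'I_p} -> B,
  (forall alpha, exists2 b1, range iota b1 & c alpha = b1 * \prod_i y i ^+ alpha i) /\
  b = \sum_alpha c alpha.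
Hypothesis der_hyp : derivation_hypothesis F A1.
Hypothesis I_ideal : two_sided_ideal I.

Let B_dom : is_comm_domain B. Proof. by case: B_ufd. Qed.
Let U_dom : is_comm_domain U. Proof. by case: U_ufd. Qed.
Let iota_inj : injective iota. Proof. exact: gr_incl_inj. Qed.
Let p_prime : prime p. Proof. exact: pcharf_prime p_char. Qed.
Let y_pow i : range iota (y i ^+ p). Proof. exact: B_pow. Qed.

Lemma gr_char : p%:R = 0 :> B.
Proof.
have pA : (p%:R : A) = 0.
  by rewrite -[1]scale1r -scaler_nat scalerA (pcharf0 p_char) mul0r scale0r.
have E k : (k%:R : B) = S 0 k%:R.
  elim: k => [|k IHk]; first by rewrite sy0.
  have Fk : F 0 k%:R.
    by elim: (k) => [|k' IH]; [exact: fil0|rewrite -natr1; apply: filD IH (fil1 F)].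
  by rewrite -!natr1 syD // ?IHk ?sy1 //; exact: fil1.
by rewrite E pA sy0.
Qed.

Let pd := pderiv y_basis.

Lemma pderiv_derivation i : y i <> 0 -> is_derivation A1 (pd i : gr F -> gr F).
Proof.
move=> yi; split=> [b c|b c|c b cB].
- exact: (pderivD B_dom y_basis i b c).
- exact: (pderivM B_dom p_prime gr_char y_pow y_basis b c yi).
- exact: (pderivZ B_dom y_basis i b cB).
Qed.

Lemma hcomp_B1 n (b : B) : range iota b -> exists2 x, A1s x & F n x /\ hcomp S n b = S n x.
Proof. by move=> [u _ <-]; exact: gr_incl_comp. Qed.

Lemma sy_B1 n x : A1s x -> F n x -> range iota (S n x).
Proof.
move=> xA Fx; exists (symb (sub_filtration F A1) n (Subring xA)) => //.
exact: (@gr_incl_symb A F A1 n (Subring xA) Fx).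
Qed.

Lemma src_bracketM (a : source F A1) r (b c : gr F) : homogeneous b -> homogeneous c ->
  src_bracket a r (b * c) = src_bracket a r b * c + b * src_bracket a r c.
Proof.
move=> [n [x [Fx ->]]] [m [z [Fz ->]]]; rewrite symbM //.
have Fax := src_deg a r Fx; have Faz := src_deg a r Fz.
rewrite /src_bracket (gr_map_symb _ Fx) (gr_map_symb _ Fz) (gr_map_symb _ (filM Fx Fz)).
rewrite symbM // symbM // [n + (m - _)]addrA [n - _ + m]addrAC.
rewrite -[RHS](@syD _ _ _ S).
- congr symb; rewrite -[LHS]/(a r * (x * z) - x * z * a r).
  rewrite -[RHS]/((a r * x - x * a r) * z + x * (a r * z - z * a r)).
  by rewrite mulrBl mulrBr !mulrA addrA subrK.
- by rewrite addrAC; exact: filM.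
- by rewrite -addrA; exact: filM.
Qed.

Definition symbol_gcd (X : B) : Prop :=
  (forall n v, I v -> F n v -> dvd X (S n v)) /\
  (forall q, prime_elt q -> exists n v,
    [/\ I v, F n v & exists2 s, S n v = X * s & ~ dvd q s]).

Lemma symbol_gcd_ex : (exists2 c, I c & c <> 0) ->
  exists dX x1, [/\ A1s x1, F dX x1, S dX x1 <> 0 & symbol_gcd (S dX x1)].
Proof.
move=> [c Ic c0]; have fac := ufd_prime_factorial B_ufd.
have [I0 ID Il Ir] := I_ideal.
pose G : set B := [set b | exists n v, [/\ I v, F n v & b = S n v]].
have [nc Fc Sc0] := sy_degree S c0.
have [|X X0 [XG Xco]] := gcd_exists B_dom (G := G) fac.
  by exists (S nc c) => //; exists nc, c.
have Xhom (Z : B) : Z <> 0 -> dvd Z X -> homog S Z.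
  move=> Z0 ZX; apply: (homog_dvd B_dom (c := S nc c)) => //; first by exists nc, c.
  by apply: dvd_trans ZX _; apply: XG; exists nc, c.
(* If X s is the symbol of v in I, then X divides the bracket of X s, because [a_r, v] lies in I; by
   the Leibniz rule it divides the bracket of X times s. The cofactors s have no common prime, so X
   divides the bracket of X. *)
have Xclos (a : source F A1) r : dvd X (src_bracket a r X).
  apply: (coprime_set_dvd B_dom fac Xco X0) => s [n [v [Iv Fv vE]]].
  have [s0|s0] := pselect (s = 0); first by rewrite s0 mulr0; exact: dvd0.
  have shom : homog S s.
    apply: (homog_dvd B_dom (c := S n v)); first by exists n, v.
      by rewrite -vE; exact: (dom_mulf_neq0 B_dom).
    by rewrite -vE; exists X; rewrite mulrC.
  have := src_bracketM a r (Xhom X X0 (dvd_refl X)) shom.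
  rewrite [in X in X -> _]vE => E.
  rewrite (_ : _ * s = src_bracket a r (S n v) - X * src_bracket a r s); last first.
    by rewrite /= E [RHS]addrK.
  apply: dvdB; last by exists (src_bracket a r s).
  rewrite /src_bracket (gr_map_symb _ Fv); apply: XG.
  exists (n - (theta a r)%:Z), (ad (a r) v); split=> //; last exact: src_deg.
  rewrite /= /ad; apply: ID; first exact: Il.
  by rewrite -mulrN1; apply: (Ir); exact: Ir.
(* The derivation hypothesis is used with Y = X; the closure condition holds for all indices r,
   hence the bound 0. *)
have Xpd i : y i <> 0 -> dvd X (pd i X).
  move=> yi; apply: (proj1 (@principalE B X _)).
  have [n [x [Fx XE]]] := Xhom X X0 (dvd_refl X).
  have hX : homogeneous (X : gr F) by exists n, x.
  apply: (der_hyp hX hX) => [a|]; last exact: pderiv_derivation.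
  by split=> //; exists 0%N => r _; exact: (proj2 (@principalE B X _) (Xclos a r)).
have Xcoef := dvd_coef_self B_dom p_prime gr_char y_pow Xpd.
have [g Xg gX] := generator_descent B_dom iota_inj U_dom (ufd_prime_factorial U_ufd) X0 Xcoef.
have g0 : iota g <> 0 by move=> g0; apply: X0; case: gX => w ->; rewrite g0 mul0r.
(* As a divisor of the homogeneous X, [iota g] is homogeneous, hence the symbol of an element of
   A1. *)
have [n [x [Fx gE]]] := Xhom (iota g) g0 gX.
have [x1 A1x1 [Fx1 x1E]] := hcomp_B1 n (imageT iota g).
have SgE : S n x1 = iota g by rewrite -x1E gE hcomp_syE.
have [c' XE] := gX; have [d' gE'] := Xg.
(* X and [iota g] are associates, so the cofactors relative to [iota g] still have no common
   prime. *)
have cd : c' * d' = 1.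
  by apply: (dom_mulfI B_dom g0); rewrite mulr1 mulrA -XE -gE'.
exists n, x1; rewrite SgE; split=> //; split=> [m v Iv Fv|q qP].
  by apply: dvd_trans gX _; apply: XG; exists m, v.
have [s [m [v [Iv Fv vE]]] nqs] := Xco q qP.
exists m, v; split=> //; exists (c' * s); first by rewrite -vE XE mulrA.
move=> qcs; apply: nqs; rewrite -[s]mul1r -cd -mulrA mulrCA; exact: dvd_mull.
Qed.

Lemma symbol_lower dX x1 : A1s x1 -> F dX x1 -> symbol_gcd (S dX x1) ->
  forall w1 eps m, A1s w1 -> F m eps -> I (w1 + eps) ->
  exists2 z, A1s z & F m z /\ dvd (S dX x1) (S m eps - S m z).
Proof.
move=> A1x1 Fx1 [XG _] w1 eps m A1w Feps Iw; set X := S dX x1.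
have [I0 ID Il Ir] := I_ideal.
have hX : homogeneous (X : gr F) by exists dX, x1.
have hY : homogeneous (S m eps : gr F) by exists m, eps.
have closure (a : source F A1) : src_closure a (principal (X : gr F)) (S m eps : gr F).
  split=> //; have [k Fk] := fil_ex F w1.
  (* With this margin theta1 exceeds theta by more than k - m, so [a_r, w1] lies below degree m -
     theta. The bracket of the symbol of eps is then the symbol of [a_r, w1 + eps], an element of
     I. *)
  have [N NP] := src_lim a (absz (k - m)%R).+1; exists N => r /NP th.
  apply: (proj2 (@principalE B X _)); rewrite /src_bracket (gr_map_symb _ Feps).
  set n := m - (theta a r)%:Z.
  have Fw : F (n - 1) (ad (a r) w1).
    by apply: (fil_le _ (src_deg1 a r A1w Fk)); rewrite /n; lia.
  have Fe : F n (ad (a r) eps) by exact: src_deg.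
  have Fw' : F n (ad (a r) w1) by apply: (fil_le _ Fw); lia.
  have -> : symb F n (ad (a r) eps) = S n (ad (a r) (w1 + eps)).
    rewrite raddfD (syD S Fw' Fe).
    by rewrite (proj2 (sy_eq0 S Fw') Fw) add0r.
  apply: XG; last by rewrite raddfD; exact: filD.
  rewrite /= /ad; apply: ID; first exact: Il.
  by rewrite -mulrN1; apply: (Ir); exact: Ir.
have [i yi|b0 b0B [c cE]] := dvd_coef B_dom p_prime gr_char (y_basis := y_basis) (sy_B1 A1x1 Fx1)
    (b := S m eps).
  apply: (proj1 (@principalE B X _)); apply: (der_hyp hX hY closure).
  exact: pderiv_derivation.
have [z A1z [Fz zE]] := hcomp_B1 m b0B; exists z => //; split=> //.
(* The constant part of the symbol of eps need not be homogeneous; passing to components of degree m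
   preserves divisibility because X is homogeneous. *)
exists (hcomp S (m - dX) c); rewrite -zE -(hcomp_syE S Feps) -raddfB cE.
by rewrite mulrC hcomp_mul_sy // mulrC.
Qed.

Lemma power_B1 n x : F n x -> exists2 z, A1s z & F (n *+ p) z /\ S n x ^+ p = S (n *+ p) z.
Proof.
move=> Fx; have [z A1z [Fz zE]] := hcomp_B1 (n *+ p) (B_pow (S n x)).
exists z => //; split=> //; have [Fxp xpE] := sy_exp S p Fx.
by rewrite -zE -xpE hcomp_syE.
Qed.

Lemma lifted_monomials : exists (J : finType) (e : J -> A) (d : J -> int) (k0 : J),
  [/\ e k0 = 1, forall j, F (d j) (e j),
      forall n v, F n v -> exists c : J -> A,
        [/\ forall j, A1s (c j), forall j, F (n - d j) (c j) &
            S n v = \sum_j S (n - d j) (c j) * S (d j) (e j)] &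
      forall n (c : J -> A), (forall j, A1s (c j)) -> (forall j, F (n - d j) (c j)) ->
        \sum_j S (n - d j) (c j) * S (d j) (e j) = 0 -> forall j, S (n - d j) (c j) = 0].
Proof.
have [dx dxP] : exists dx : 'I_t -> int * A, forall i,
    F (dx i).1 (dx i).2 /\ y i = S (dx i).1 (dx i).2.
  have h i : exists u : int * A, F u.1 u.2 /\ y i = S u.1 u.2.
    by have [n [x [Fx yE]]] := y_homog i; exists (n, x).
  by have [f fP] := choice h; exists f.
pose idx := {ffun 'I_t -> 'I_p}.
pose e0 (a : idx) : A := \prod_i (dx i).2 ^+ a i.
pose d0 (a : idx) : int := \sum_i (dx i).1 *+ a i.
have e0P a : F (d0 a) (e0 a) /\ S (d0 a) (e0 a) = mon y (ev a).
  have h i : F ((dx i).1 *+ a i) ((dx i).2 ^+ a i) by apply: (sy_exp S _ _).1; have [] := dxP i.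
  have [Fe Se] := sy_prod S (index_enum 'I_t) h; split=> //.
  rewrite [LHS]Se; apply: eq_bigr => i _; have [Fx ->] := dxP i.
  by have [_ ->] := sy_exp S (a i) Fx.
(* Vanishing monomials are discarded: their coefficients are unconstrained, so keeping them would
   destroy independence. *)
pose J : finType := {a : idx | mon y (ev a) != 0}.
pose e (j : J) := e0 (val j); pose d (j : J) := d0 (val j).
have eP j : F (d j) (e j) /\ S (d j) (e j) = mon y (ev (val j)) by exact: e0P.
have sumJ (f : idx -> B) : (forall a, mon y (ev a) = 0 -> f a = 0) ->
    \sum_a f a = \sum_(j : J) f (val j).
  move=> f0; rewrite (bigID (fun a => mon y (ev a) != 0)) /= [X in _ + X]big1 ?addr0.
    rewrite (reindex_omap (val : J -> idx) insub) => [|a ma]; last by rewrite insubT.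
    by apply: eq_bigl => j; rewrite (valP j) valK eqxx.
  by move=> a /negbNE /eqP /f0.
pose a0 : idx := idx_mod p_prime (fun=> 0%N).
have a0E i : a0 i = 0%N :> nat by rewrite ffunE /= mod0n.
have m0 : mon y (ev a0) != 0.
  by rewrite /mon big1 ?oner_neq0 // => i _; rewrite /ev a0E expr0.
exists J, e, d, (Sub a0 m0); split.
- by rewrite /e /e0 big1 // => i _; rewrite a0E expr0.
- by move=> j; have [] := eP j.
- move=> n v Fv; pose c0 := coef y_basis (S n v).
  have h j : exists z, A1s z /\ F (n - d j) z /\ hcomp S (n - d j) (c0 (val j)) = S (n - d j) z.
    by have [z A1z zP] := hcomp_B1 (n - d j) (coef_B1 y_basis (S n v) (val j)); exists z.
  have [c cP] := choice h; exists c; split=> [j|j|]; [by have [] := cP j|by have [_ []] := cP j|].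
  rewrite -{1}(hcomp_syE S Fv) (coefE y_basis (S n v)) sumJ => [|a /= ma]; last first.
    by rewrite ma mulr0.
  rewrite raddf_sum; apply: eq_bigr => j _; have [Fe <-] := eP j.
  by rewrite hcomp_mul_sy //; have [_ [_ ->]] := cP j.
- move=> n c A1c Fc c0 j.
  pose f (a : idx) : B := if insub a is Some j then S (n - d j) (c j) else 0.
  have fE j' : f (val j') = S (n - d j') (c j') by rewrite /f valK.
  have f0 a : mon y (ev a) = 0 -> f a = 0.
    by move=> ma; rewrite /f insubN // ma eqxx.
  have zc : coords (p := p) iota y 0 (fun=> 0).
    split=> // [a|]; first exact: B1_0.
    by rewrite big1 // => a _; rewrite mul0r.
  have fc : coords (p := p) iota y 0 f.
    split=> // [a|].
      by rewrite /f; case: insubP => [j' _ _|_]; [exact: sy_B1|exact: B1_0].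
    rewrite sumJ => [|a /f0 ->]; last by rewrite mul0r.
    rewrite -[LHS]c0; apply: eq_bigr => j' _; rewrite fE.
    by have [_ ->] := eP j'.
  by rewrite -fE (coords_uniq B_dom y_basis fc zc).
Qed.

Let A1s0 : A1s 0. Proof. exact: rpred0. Qed.
Let A1sD x z : A1s x -> A1s z -> A1s (x + z). Proof. exact: rpredD. Qed.
Let A1sB x z : A1s x -> A1s z -> A1s (x - z). Proof. exact: rpredB. Qed.
Let A1sM x z : A1s x -> A1s z -> A1s (x * z). Proof. exact: rpredM. Qed.
Let A1sM_op (x z : A^c) : A1s x -> A1s z -> A1s (x * z).
Proof. by move=> xA zA; exact: A1sM. Qed.

(* The right-hand statements are the left-hand ones for the opposite ring. *)
Lemma controlled_bases : reflexive_ideal I ->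
  exists (J : finType) (e : J -> A) (k0 : J) (lam rho : A -> J -> subring A1),
  [/\ e k0 = 1,
      (forall r, r = \sum_k val (lam r k) * e k) /\
      (forall r c, r = \sum_k val (c k : subring A1) * e k -> lam r = c),
      (forall r, r = \sum_k e k * val (rho r k)) /\
      (forall r c, r = \sum_k e k * val (c k : subring A1) -> rho r = c) &
      forall r k, I r -> I (val (lam r k)) /\ I (val (rho r k))].
Proof.
move=> [hI [reflL reflR]]; have [J [e [d [k0 [e1 Fe span indep]]]]] := lifted_monomials.
have fac := ufd_prime_factorial B_ufd; have [I0 ID Il Ir] := I_ideal.
pose S' := op_symbol_map S.
have F_complete' : fil_complete (op_fil F) := F_complete.
have spanL := lifted_basis_span (S := S) F_complete A1_closed A1s0 A1sD Fe span.
have spanR := lifted_basis_span (S := S') F_complete' A1_closed A1s0 A1sD Fe span.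
have indepL := lifted_basis_indep (S := S) Fe indep.
have indepR := lifted_basis_indep (S := S') Fe indep.
have oreL := left_ore S F_complete B_noeth.
have oreR := left_ore S' F_complete' B_noeth.
have p_gt0 := prime_gt0 p_prime.
have controlL (c : J -> A) : (forall j, A1s (c j)) -> I (\sum_j c j * e j) -> forall j, I (c j).
  (* The zero ideal has no symbol gcd; there the claim is independence of the basis. *)
  move=> A1c Ic j; have [nz|z] := pselect (exists2 v, I v & v <> 0); last first.
    rewrite (indepL c) //; apply: contrapT => nz; apply: z.
    by exists (\sum_j c j * e j).
  have [dX [x1 [A1x1 Fx1 X0 Xgcd]]] := symbol_gcd_ex nz; have [Xdvd Xco] := Xgcd.
  apply: (reflexive_mem (S := S) F_complete B_dom B_noeth fac oreR I_ideal
    (@left_val_linear _ _ hI) val_inj (left_val_range hI) reflL nz).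
  exact: (coord_locally_in (S := S) B_dom A1sB A1sM spanL indepL I_ideal p_gt0
    power_B1 A1x1 Fx1 X0 Xdvd Xco (symbol_lower A1x1 Fx1 Xgcd) A1c Ic).
have controlR (c : J -> A) : (forall j, A1s (c j)) -> I (\sum_j e j * c j) -> forall j, I (c j).
  move=> A1c Ic j; have [nz|z] := pselect (exists2 v, I v & v <> 0); last first.
    rewrite (indepR c) //; apply: contrapT => nz; apply: z.
    by exists (\sum_j e j * c j).
  have [dX [x1 [A1x1 Fx1 X0 Xgcd]]] := symbol_gcd_ex nz; have [Xdvd Xco] := Xgcd.
  apply: (reflexive_mem (S := S') F_complete' B_dom B_noeth fac oreL (op_two_sided hI)
    (@right_val_linear _ _ hI) val_inj (right_val_range hI) reflR nz).
  exact: (coord_locally_in (S := S') B_dom A1sB A1sM_op spanR indepR (op_two_sided hI) p_gt0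
    power_B1 A1x1 Fx1 X0 Xdvd Xco (symbol_lower A1x1 Fx1 Xgcd) A1c Ic).
have lamEx r : exists c : J -> subring A1, r = \sum_k val (c k) * e k.
  have [n Fr] := fil_ex F r; have [c [A1c _ ->]] := spanL n r Fr.
  by exists (fun k => Subring (A1c k)).
have rhoEx r : exists c : J -> subring A1, r = \sum_k e k * val (c k).
  have [n Fr] := fil_ex F r; have [c [A1c _ ->]] := spanR n r Fr.
  by exists (fun k => Subring (A1c k)).
have [lam lamE] := choice lamEx; have [rho rhoE] := choice rhoEx.
exists J, e, k0, lam, rho; split=> //; [split=> // r c rE|split=> // r c rE|].
- apply/funext => k; apply: val_inj; apply/subr0_eq.
  apply: (indepL (fun k => val (lam r k) - val (c k))) => [j|].
    by apply: A1sB; exact: subring_valP.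
  under eq_bigr => j _ do rewrite mulrBl.
  by rewrite sumrB -lamE -rE subrr.
- apply/funext => k; apply: val_inj; apply/subr0_eq.
  apply: (indepR (fun k => val (rho r k) - val (c k))) => [j|].
    by apply: A1sB; exact: subring_valP.
  have E j : ((val (rho r j) - val (c j) : A^c) * (e j : A^c)) =
      (e j * val (rho r j) - e j * val (c j) : A) by exact: (@mulrBr A).
  by rewrite (eq_bigr _ (fun j _ => E j)) [LHS]sumrB -rhoE -rE subrr.
- move=> r k Ir'; split.
    apply: (controlL (fun k => val (lam r k))) => [j|]; first exact: subring_valP.
    by rewrite -lamE.
  apply: (controlR (fun k => val (rho r k))) => [j|]; first exact: subring_valP.
  by rewrite -rhoE.
Qed.

Lemma frobenius_control : reflexive_ideal I ->
  reflexive_ideal [set x : subring A1 | I (val x)] /\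
  I = mul_set (I `&` [set x | x \in A1]) setT.
Proof.
move=> I_refl; have [I0 ID Il Ir] := I_ideal.
have [J [e [k0 [lam [rho [e1 [lamE lamU] [rhoE rhoU] ctrl]]]]]] := controlled_bases I_refl.
have [hI [reflL reflR]] := I_refl; split.
  have h1 : two_sided_ideal [set x : subring A1 | I (val x)].
    split=> [|x z Ix Iz|a x Ix|a x Ix].
    - exact: I0.
    - exact: (ID _ _ Ix Iz).
    - exact: (Il (val a) _ Ix).
    - exact: (Ir (val a) _ Ix).
  exists h1; split.
    refine (@reflexive_descent A (subring A1) val J e k0 _ _ _ e1 lam rho lamE lamU rhoE rhoU I
      (left_ideal_mod hI) (fun m => val m) (left_ideal_mod h1) (fun m => val m)
      (@left_val_linear _ _ hI) val_inj (left_val_range hI)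
      (@left_val_linear _ _ h1) val_inj (left_val_range h1) _ reflL).
    - exact: raddfD.
    - exact: rmorphM.
    - exact: val_inj.
    - by move=> r k /(ctrl r k) [].
  (* Passing to the opposite rings exchanges the two coordinate families, so functionals are now
     restricted through [rho] and extended through [lam]. *)
  refine (@reflexive_descent A^c (subring A1)^c val J e k0 _ _ _ e1 rho lam
    rhoE rhoU lamE lamU I
    (right_ideal_mod hI) (fun m => val m) (right_ideal_mod h1) (fun m => val m)
    (@right_val_linear _ _ hI) val_inj (right_val_range hI)
    (@right_val_linear _ _ h1) val_inj (right_val_range h1) _ reflR).
  - exact: raddfD.
  - by move=> x z; exact: (rmorphM (val : {rmorphism subring A1 -> A})).
  - exact: val_inj.
  - by move=> r k /(ctrl r k) [].
apply/seteqP; split=> v.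
  move=> Iv; exists #|J|, (fun i => val (lam v (enum_val i))), (fun i => e (enum_val i)).
  split=> // [i|]; first by split; [have [] := ctrl v (enum_val i) Iv|exact: subring_valP].
  by rewrite {1}(lamE v) -(big_enum_val (A := J) (fun k => val (lam v k) * e k)).
move=> [n [s [u [sI _ ->]]]]; elim/big_ind: _ => // i _.
by have [Is _] := sI i; exact: Ir.
Qed.

End FrobeniusPair.

Theorem theorem5p3 (K : fieldType) (p : nat) (A : algType K)
    (F : filtration A) (A1 : subringClosed A) (I : set A) :
  p \in [pchar K] ->
  frobenius_pair p F A1 ->
  derivation_hypothesis F A1 ->
  is_ufd (gr F) ->
  is_ufd (gr (sub_filtration F A1)) ->
  reflexive_ideal I ->
  reflexive_ideal [set x : subring A1 | I (val x)] /\
  I = mul_set (I `&` [set x | x \in A1]) setT.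
Proof.
move=> pK [[Fc _] A1c [B_dom B_noeth] Bp [t [y [_ yh yb]]]] der B_ufd U_ufd I_refl.
have mC : commutative (@GRing.mul (gr F)) by case: B_dom.
have mC1 : commutative (@GRing.mul (gr (sub_filtration F A1))) by case: U_ufd => -[].
have [hI _] := I_refl.
exact: (frobenius_control pK (mC := mC) (mC1 := mC1) Fc A1c B_ufd U_ufd B_noeth
  Bp yh yb der hI I_refl).
Qed.
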